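(* Let $f:\mathbb{R}^n\to\mathbb{R}$, $g:\mathbb{R}^n\to\mathbb{R}^m$, $h:\mathbb{R}^n\to\mathbb{R}^p$, $\Phi_i:\mathbb{R}^n\to\mathbb{R}^q$ ($i=1,\dots,l$) be continuously differentiable, let $S=\bigcup_{r=1}^R S_r\subseteq\mathbb{R}^q$ with each $S_r$ a linear subspace, and consider the problem (MPDSC) of minimizing $f(x)$ over the feasible set $\mathcal{F}=\{x\in\mathbb{R}^n : g(x)\le 0,\ h(x)=0,\ \Phi_i(x)\in S,\ i=1,\dots,l\}$. Suppose that $x^*\in\mathcal{F}$ and that MPDSC-RCPLD holds at $x^*$. Then the error bound property holds at $x^*$: there exist $\alpha\ge 0$ and $\rho>0$ such that $$d_{\mathcal{F}}(x)\le \alpha\Bigl(\sum_{i=1}^m\max\{g_i(x),0\}+\sum_{i=1}^p|h_i(x)|+\sum_{i=1}^l d_S(\Phi_i(x))\Bigr)\qquad\text{for all } x\in\mathbb{B}_\rho(x^* ).$$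
   Context: Notation. $\mathbb{B}_\varepsilon(x)$ is the open ball of radius $\varepsilon$ around $x$; $d_\Omega(x)$ is the distance from $x$ to $\Omega$ (in a fixed norm). $\mathcal{I}_g(x^* )=\{i : g_i(x^* )=0\}$. For $y\in S$, $I(y)=\{r\in\{1,\dots,R\} : y\in S_r\}$. For a finite set $A$ of linearly independent vectors, $\mathcal{G}(A)=\operatorname{span}(A)$ (with $\mathcal{G}(\emptyset)=\{0\}$). $\nabla\Phi_i(x)$ denotes the Jacobian of $\Phi_i$ at $x$. Generator sets. $\hat N_S(y)$ and $N_S(y)$ denote the Fréchet (regular) and the Mordukhovich (limiting) normal cone to $S$ at $y\in S$. For $y\in S$, $\hat N_S(y)=\bigcap_{r\in I(y)}S_r^\perp$ is a subspace, and $\hat A_S(y)$ denotes a (fixed) set of linearly independent vectors with $\hat N_S(y)=\mathcal{G}(\hat A_S(y))$. There is $\delta>0$ with $N_S(y)=\bigcup_{y'\in \mathbb{B}_\delta(y)\cap S}\hat N_S(y')$; with such a $\delta$, put $A_S(y)=\bigcup_{y'\in\mathbb{B}_\delta(y)\cap S}\hat A_S(y')$. MPDSC-RCPLD (relaxed constant positive linear dependence) holds at $x^*\in\mathcal{F}$ if: (i) there is $\varepsilon>0$ such that the vectors $\{\nabla h_i(x)\}_{i=1}^p$ have the same rank for all $x\in\mathbb{B}_\varepsilon(x^* )$; (ii) let $J\subseteq\{1,\dots,p\}$ be such that $\{\nabla h_i(x^* )\}_{i\in J}$ is a basis of $\operatorname{span}\{\nabla h_i(x^* )\}_{i=1}^p$.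 Whenever there are an index set $I\subseteq\mathcal{I}_g(x^* )$ and multipliers $(\lambda^g_i)_{i\in I}$, $(\lambda^h_i)_{i\in J}$, $(\lambda^\Phi_i)_{i=1}^l$ with $\lambda^\Phi_i\in\mathbb{R}^q$, not all zero, with $\lambda^g_i\ge0$ for $i\in I$ and $\lambda^\Phi_i\in\bigcup_{r\in I(\Phi_i(x^* ))}S_r^\perp$ for $i=1,\dots,l$, satisfying $$0=\sum_{i\in I}\lambda^g_i\nabla g_i(x^* )+\sum_{i\in J}\lambda^h_i\nabla h_i(x^* )+\sum_{i=1}^l\nabla\Phi_i(x^* )^T\lambda^\Phi_i,$$ then for every sequence $x^k\to x^*$ with $x^k\ne x^*$, and all sets $A_i$ of linearly independent vectors ($i=1,\dots,l$) such that - if $\lambda_i^\Phi\neq0$ then $A_i\subseteq A_S(\Phi_i(x^* ))$ and $\lambda^\Phi_i\in\mathcal{G}(A_i)\subseteq\bigcup_{r\in I(\Phi_i(x^* ))}S_r^\perp$, - if $\lambda_i^\Phi=0$ then $A_i=\emptyset$, the family of vectors $\{\nabla g_i(x^k)\}_{i\in I}\cup\{\nabla h_i(x^k)\}_{i\in J}\cup\{\nabla\Phi_i(x^k)^T\beta_i : \beta_i\in A_i,\ i=1,\dots,l\}$ is linearly dependent for all sufficiently large $k$. *)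

(* Defs.v *)
From HB Require Import structures.
From mathcomp Require Import all_boot all_order all_algebra.
From mathcomp Require Import all_classical all_reals all_analysis.

Set Implicit Arguments.
Unset Strict Implicit.
Unset Printing Implicit Defensive.

Import Order.TTheory GRing.Theory Num.Theory.
Import numFieldNormedType.Exports.

Local Open Scope classical_set_scope.
Local Open Scope ring_scope.

(* Points of R^n are row vectors ['rV[R]_n].  Distances and balls are taken in
   arbitrary norms; convergence and differentiability, which do not depend on
   the norm in finite dimension, are those of the library. *)

Definition is_norm (R : realType) (V : lmodType R) (N : V -> R) : Prop :=
  [/\ forall x, N x = 0 -> x = 0,
      forall x y, N (x + y) <= N x + N y
    & forall a x, N (a *: x) = `|a| * N x].

Definition norm_ball (R : realType) (V : lmodType R) (N : V -> R)
    (x : V) (e : R) : set V :=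
  [set y | N (y - x) < e].

(* [inf] is the genuine infimum only if [Om] is nonempty. *)
Definition norm_dist (R : realType) (V : lmodType R) (N : V -> R)
    (Om : set V) (x : V) : R :=
  inf [set N (x - y) | y in Om].

(* The differential exists everywhere and is continuous in operator norm. *)
Definition continuously_differentiable (R : realType) (V W : normedModType R)
    (f : V -> W) : Prop :=
  (forall x, differentiable f x) /\
  (forall x (e : R), 0 < e ->
     \forall y \near nbhs x, forall v, `|'d f y v - 'd f x v| <= e * `|v|).

Definition dotp (R : realType) (q : nat) (u v : 'rV[R]_q) : R :=
  \sum_(j < q) u 0 j * v 0 j.

(* The library's ['J f x] acts on row vectors from the right, so it is the
   transpose of the usual Jacobian: the gradient of the i-th component is the
   i-th column of ['J f x], and the usual J^T lam is [lam *m ('J f x)^T]. *)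
Definition grad (R : realType) (n m : nat) (g : 'rV[R]_n -> 'rV[R]_m)
    (i : 'I_m) (x : 'rV[R]_n) : 'rV[R]_n :=
  (col i ('J g x))^T.

Definition jacT (R : realType) (n q : nat) (F : 'rV[R]_n -> 'rV[R]_q)
    (x : 'rV[R]_n) (lam : 'rV[R]_q) : 'rV[R]_n :=
  lam *m ('J F x)^T.

(* limsup of <v, z - y> / |z - y|, as z -> y in Om with z <> y, is <= 0. *)
Definition frechet_normal_cone (R : realType) (q : nat)
    (Om : set 'rV[R]_q) (y : 'rV[R]_q) : set 'rV[R]_q :=
  [set v | forall e : R, 0 < e ->
     \forall z \near within Om (nbhs y), dotp v (z - y) <= e * `|z - y|].

Definition limiting_normal_cone (R : realType) (q : nat)
    (Om : set 'rV[R]_q) (y : 'rV[R]_q) : set 'rV[R]_q :=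
  [set v | exists (z w : nat -> 'rV[R]_q),
     [/\ forall k, Om (z k), z @ \oo --> y, w @ \oo --> v
       & forall k, frechet_normal_cone Om (z k) (w k)]].

Definition union_of_subspaces (R : realType) (q N : nat)
    (Sr : 'I_N -> {vspace 'rV[R]_q}) : set 'rV[R]_q :=
  [set y | exists r, y \in Sr r].

Definition orthogonal_complement (R : realType) (q : nat)
    (U : {vspace 'rV[R]_q}) : set 'rV[R]_q :=
  [set v | forall s, s \in U -> dotp v s = 0].

Definition active_branches (R : realType) (q N : nat)
    (Sr : 'I_N -> {vspace 'rV[R]_q}) (y : 'rV[R]_q) : set 'I_N :=
  [set r | y \in Sr r].

Definition active_orthogonals (R : realType) (q N : nat)
    (Sr : 'I_N -> {vspace 'rV[R]_q}) (y : 'rV[R]_q) : set 'rV[R]_q :=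
  \bigcup_(r in active_branches Sr y) orthogonal_complement (Sr r).

(* [Ahat y] is the chosen set of linearly independent generators of the Frechet
   normal cone at y, and [delta y] the chosen radius. *)
Definition generator_choice (R : realType) (q : nat) (N : 'rV[R]_q -> R)
    (S : set 'rV[R]_q) (Ahat : 'rV[R]_q -> seq 'rV[R]_q)
    (delta : 'rV[R]_q -> R) : Prop :=
  forall y, S y ->
    [/\ free (Ahat y),
        frechet_normal_cone S y = [set v | v \in <<Ahat y>>%VS],
        0 < delta y
      & limiting_normal_cone S y =
        \bigcup_(z in norm_ball N y (delta y) `&` S) frechet_normal_cone S z].

Definition generator_set (R : realType) (q : nat) (N : 'rV[R]_q -> R)
    (S : set 'rV[R]_q) (Ahat : 'rV[R]_q -> seq 'rV[R]_q)
    (delta : 'rV[R]_q -> R) (y : 'rV[R]_q) : set 'rV[R]_q :=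
  \bigcup_(z in norm_ball N y (delta y) `&` S) [set a | a \in Ahat z].

Definition feasible_set (R : realType) (n m p l q : nat)
    (g : 'rV[R]_n -> 'rV[R]_m) (h : 'rV[R]_n -> 'rV[R]_p)
    (Phi : 'I_l -> 'rV[R]_n -> 'rV[R]_q) (S : set 'rV[R]_q) : set 'rV[R]_n :=
  [set x | [/\ forall i, g x 0 i <= 0, h x = 0 & forall i, S (Phi i x)]].

Definition constraint_family (R : realType) (n m p l q : nat)
    (g : 'rV[R]_n -> 'rV[R]_m) (h : 'rV[R]_n -> 'rV[R]_p)
    (Phi : 'I_l -> 'rV[R]_n -> 'rV[R]_q)
    (I : {set 'I_m}) (J : {set 'I_p}) (A : 'I_l -> seq 'rV[R]_q)
    (x : 'rV[R]_n) : seq 'rV[R]_n :=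
  [seq grad g i x | i <- enum I] ++
  [seq grad h i x | i <- enum J] ++
  flatten [seq [seq jacT (Phi i) x b | b <- A i] | i <- enum 'I_l].

Definition MPDSC_RCPLD (R : realType) (n m p l q N : nat)
    (nX : 'rV[R]_n -> R) (nY : 'rV[R]_q -> R)
    (g : 'rV[R]_n -> 'rV[R]_m) (h : 'rV[R]_n -> 'rV[R]_p)
    (Phi : 'I_l -> 'rV[R]_n -> 'rV[R]_q)
    (Sr : 'I_N -> {vspace 'rV[R]_q})
    (Ahat : 'rV[R]_q -> seq 'rV[R]_q) (delta : 'rV[R]_q -> R)
    (xs : 'rV[R]_n) : Prop :=
  (exists2 e : R, 0 < e & forall x, norm_ball nX xs e x ->
     \dim <<[seq grad h i x | i : 'I_p]>>%VS =
     \dim <<[seq grad h i xs | i : 'I_p]>>%VS) /\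
  (forall J : {set 'I_p},
     basis_of <<[seq grad h i xs | i : 'I_p]>>%VS
              [seq grad h i xs | i <- enum J] ->
   forall (I : {set 'I_m}) (lg : 'I_m -> R) (lh : 'I_p -> R)
          (lPhi : 'I_l -> 'rV[R]_q),
     (forall i, i \in I -> g xs 0 i = 0) ->
     [\/ exists2 i, i \in I & lg i != 0,
         exists2 i, i \in J & lh i != 0
       | exists i, lPhi i != 0] ->
     (forall i, i \in I -> 0 <= lg i) ->
     (forall i, active_orthogonals Sr (Phi i xs) (lPhi i)) ->
     0 = \sum_(i in I) lg i *: grad g i xs
       + \sum_(i in J) lh i *: grad h i xs
       + \sum_(i < l) jacT (Phi i) xs (lPhi i) ->
   forall (x : nat -> 'rV[R]_n) (A : 'I_l -> seq 'rV[R]_q),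
     x @ \oo --> xs ->
     (forall k, x k != xs) ->
     (forall i, free (A i)) ->
     (forall i, lPhi i != 0 ->
        [/\ [set a | a \in A i] `<=`
              generator_set nY (union_of_subspaces Sr) Ahat delta (Phi i xs),
            lPhi i \in <<A i>>%VS
          & [set v | v \in <<A i>>%VS] `<=`
              active_orthogonals Sr (Phi i xs)]) ->
     (forall i, lPhi i = 0 -> A i = [::]) ->
     \forall k \near \oo, ~~ free (constraint_family g h Phi I J A (x k))).

(* Main.v *)
Require Import Defs.
From HB Require Import structures.
From mathcomp Require Import all_boot all_order all_algebra.
From mathcomp Require Import all_classical all_reals all_analysis.
From mathcomp Require Import ring lra.
(** On each piece of the feasible set where every Phi_i stays in one fixed
    subspace, the problem is an ordinary nonlinear program with scalar
    inequalities and equations, and the error bound is proved for such a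
    program by a quadratic penalty.

    Reduction to scalar constraints.  Near xs the subspace that is nearest to
    Phi_i(x) contains Phi_i(xs).  Enlarge it to a maximal S_r.  There are points
    z of S_r arbitrarily close to Phi_i(xs) that lie in no subspace other than
    subspaces of S_r ([dominant_branch]), and at such a z the Frechet normal
    cone of the union is exactly the orthogonal complement of S_r.  Hence the
    generators B_i chosen at z span that complement, belong to the generator set
    at Phi_i(xs), and the system <b, Phi_i(x)> = 0, b in B_i, says precisely that
    Phi_i(x) lies in S_r ([branch_generators]).  RCPLD then becomes a statement
    on one finite family of scalar constraints ([rcpld_index]): a nontrivial
    combination of gradients that vanishes at xs, with nonnegative weights on
    the inequalities, forces the gradients involved to be linearly dependent
    near xs.

    Error bound for scalar constraints.  For x near xs let z minimise
    |z - x|_2^2 + j * (sum of squared violations) over a closed ball.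
    Stationarity writes x - z as a combination of the gradients at z of the
    violated constraints, with nonnegative weights on the inequalities.  The
    constant rank of the gradients of h replaces them by a basis, and a
    Caratheodory reduction that keeps this basis makes the family linearly
    independent ([caratheodory]).  On independent families RCPLD excludes
    vanishing combinations at xs, so by compactness the weights are at most
    M |x - z| ([reduced_multiplier_bound]).  Pairing the identity with x - z and
    using strict differentiability gives |x - z|^2 <= M |x - z| (r(x) + r(z)) up
    to a small multiple of |x - z|^2, where r is the total violation
    ([stationary_distance]).  Since r(z) tends to 0 as j grows, compactness
    yields a feasible y with |x - y| <= M' r(x) ([scalar_error_bound]).

    The passage from a selection of subspaces to the union is harmless because
    there are finitely many selections and the distance to the union is
    approached inside one of the active subspaces ([active_branch_approx]). *)

Set Implicit Arguments.
Unset Strict Implicit.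
Unset Printing Implicit Defensive.
Import Order.TTheory GRing.Theory Num.Theory.
Import numFieldNormedType.Exports.
Local Open Scope classical_set_scope.
Local Open Scope ring_scope.

(** * Row vectors: sup norm, inner product, minima on compact sets *)
Section SupNorm.
Variables (R : realType) (n : nat).
Implicit Types (x y u v : 'rV[R]_n) (a : R).

Lemma coord_le_norm x i : `|x 0 i| <= `|x|.
Proof.
rewrite [leRHS]/Num.Def.normr/= mx_normrE.
exact: (le_bigmax _ (fun ij => `|x ij.1 ij.2|) (0, i)).
Qed.

Lemma norm_le_coord x a : 0 <= a -> (forall i, `|x 0 i| <= a) -> `|x| <= a.
Proof.
move=> a0 xa; rewrite [leLHS]/Num.Def.normr/= mx_normrE (bigmax_le _ a0)//=.
by case=> i j _ /=; rewrite (ord1 i).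
Qed.

Lemma dotpE u v : dotp u v = (u *m v^T) 0 0.
Proof. by rewrite mxE; apply: eq_bigr => j _; rewrite mxE. Qed.

Lemma dotpC u v : dotp u v = dotp v u.
Proof. by apply: eq_bigr => j _; rewrite mulrC. Qed.

Lemma dotpDl u v y : dotp (u + v) y = dotp u y + dotp v y.
Proof. by rewrite !dotpE mulmxDl mxE. Qed.

Lemma dotpZl a u y : dotp (a *: u) y = a * dotp u y.
Proof. by rewrite !dotpE -scalemxAl mxE. Qed.

Lemma dotpNl u y : dotp (- u) y = - dotp u y.
Proof. by rewrite -scaleN1r dotpZl mulN1r. Qed.

Lemma dotpBl u v y : dotp (u - v) y = dotp u y - dotp v y.
Proof. by rewrite dotpDl dotpNl. Qed.

Lemma dotp0l y : dotp 0 y = 0.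
Proof. by rewrite dotpE mul0mx mxE. Qed.

Lemma dotpDr y u v : dotp y (u + v) = dotp y u + dotp y v.
Proof. by rewrite dotpC dotpDl !(dotpC _ y). Qed.

Lemma dotpZr a y u : dotp y (a *: u) = a * dotp y u.
Proof. by rewrite dotpC dotpZl (dotpC u). Qed.

Lemma dotpNr y u : dotp y (- u) = - dotp y u.
Proof. by rewrite dotpC dotpNl (dotpC u). Qed.

Lemma dotpBr y u v : dotp y (u - v) = dotp y u - dotp y v.
Proof. by rewrite dotpDr dotpNr. Qed.

Lemma dotp_suml (T : finType) (A : {pred T}) (F : T -> 'rV[R]_n) y :
  dotp (\sum_(t in A) F t) y = \sum_(t in A) dotp (F t) y.
Proof.
rewrite dotpE mulmx_suml summxE; apply: eq_bigr => t _.
by rewrite dotpE.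
Qed.

Lemma dotp_delta i v : dotp (delta_mx 0 i) v = v 0 i.
Proof.
rewrite /dotp (bigD1 i)//= big1 ?addr0; first by rewrite mxE !eqxx mul1r.
by move=> j ji; rewrite mxE (negPf ji) andbF mul0r.
Qed.

Lemma dotp_norm_le u v : `|dotp u v| <= n%:R * `|u| * `|v|.
Proof.
apply: le_trans (ler_norm_sum _ _ _) _.
apply: (@le_trans _ _ (\sum_(j < n) `|u| * `|v|)).
  by apply: ler_sum => j _; rewrite normrM ler_pM// coord_le_norm.
by rewrite sumr_const card_ord -mulrA mulr_natl.
Qed.

Lemma norm_sqr_le_dotp v : `|v| ^+ 2 <= dotp v v.
Proof.
have vv0 : 0 <= dotp v v by apply: sumr_ge0 => j _; rewrite -expr2 sqr_ge0.
rewrite -(sqr_sqrtr vv0) lerXn2r ?nnegrE ?sqrtr_ge0//.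
apply: norm_le_coord => [|i]; first exact: sqrtr_ge0.
rewrite -sqrtr_sqr ler_wsqrtr// /dotp (bigD1 i)//= expr2 lerDl.
by apply: sumr_ge0 => j _; rewrite -expr2 sqr_ge0.
Qed.

Lemma near_ballP (P : 'rV[R]_n -> Prop) x :
  (\forall y \near x, P y) <-> exists2 d, 0 < d & forall y, `|y - x| < d -> P y.
Proof.
split=> [/nbhs_normP[d d0 dP]|[d d0 dP]].
  by exists d => // y yx; apply: dP; rewrite /ball_/= distrC.
apply/nbhs_normP; exists d => // y; rewrite /ball_/= => yx.
by apply: dP; rewrite distrC.
Qed.

Lemma near_and (P Q : 'rV[R]_n -> Prop) x :
  (\forall y \near x, P y) -> (\forall y \near x, Q y) ->
  \forall y \near x, P y /\ Q y.
Proof. exact: (@filterI _ (nbhs x)). Qed.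

Lemma near_sub (P Q : 'rV[R]_n -> Prop) x :
  (\forall y \near x, P y) -> (forall y, P y -> Q y) -> \forall y \near x, Q y.
Proof. by move=> nP PQ; exact: (@filterS _ (nbhs x) _ P Q PQ nP). Qed.

Lemma near_all (P : 'rV[R]_n -> Prop) x : (forall y, P y) -> \forall y \near x, P y.
Proof. by move=> aP; exact: (@filterE _ (nbhs x)). Qed.

Lemma near_forall (T : finType) (P : T -> 'rV[R]_n -> Prop) x :
  (forall t, \forall y \near x, P t y) -> \forall y \near x, forall t, P t y.
Proof. exact: (@filter_forall _ _ _ (nbhs x)). Qed.

Lemma lipschitz_continuous (f : 'rV[R]_n -> R) L :
  (forall x y, `|f x - f y| <= L * `|x - y|) -> continuous f.
Proof.
move=> fL x; apply/(@cvgrPdist_le _ _ _ (nbhs x)) => e e0.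
have L1 : 0 < `|L| + 1 by rewrite ltr_wpDl.
apply/near_ballP; exists (e / (`|L| + 1)); first by rewrite divr_gt0.
move=> y yx; apply: le_trans (fL _ _) _; rewrite distrC.
apply: (@le_trans _ _ ((`|L| + 1) * `|y - x|)).
  by rewrite ler_wpM2r// (le_trans (ler_norm L))// lerDl.
by rewrite mulrC -ler_pdivlMr// ltW.
Qed.

Lemma closed_ball_compact x a : compact [set y : 'rV[R]_n | `|y - x| <= a].
Proof.
apply: bounded_closed_compact.
  exists (`|x| + a); split; first exact: num_real.
  move=> M xaM y /= yxa; apply: le_trans (ltW xaM).
  by rewrite -(subrK x y) addrC (le_trans (ler_normD _ _))// lerD2l.
have cf : continuous (fun y : 'rV[R]_n => `|y - x|).
  apply: (@lipschitz_continuous _ 1) => y z; rewrite mul1r.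
  apply: le_trans (ler_dist_dist _ _) _.
  by rewrite opprB addrA subrK.
by have /continuous_closedP /(_ _ (@closed_le R a)) := cf.
Qed.

Lemma continuous_add (f g : 'rV[R]_n -> R) :
  continuous f -> continuous g -> continuous (fun x => f x + g x).
Proof. by move=> cf cg x; apply: (continuousD (cf x) (cg x)). Qed.

Lemma continuous_mul (f g : 'rV[R]_n -> R) :
  continuous f -> continuous g -> continuous (fun x => f x * g x).
Proof. by move=> cf cg x; apply: (continuousM (cf x) (cg x)). Qed.

Lemma continuous_sum (T : finType) (f : T -> 'rV[R]_n -> R) :
  (forall t, continuous (f t)) -> continuous (fun x => \sum_t f t x).
Proof.
move=> cf; elim: (index_enum T) => [|t s IHs].
  by under eq_fun do rewrite big_nil; exact: cst_continuous.
by under eq_fun do rewrite big_cons; exact: continuous_add.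
Qed.

Lemma continuous_sqr_dist x : continuous (fun z : 'rV[R]_n => dotp (z - x) (z - x)).
Proof.
apply: continuous_sum => i.
have cc : continuous (fun z : 'rV[R]_n => (z - x) 0 i).
  apply: (@lipschitz_continuous _ 1) => y z; rewrite mul1r.
  rewrite (_ : _ - _ = (y - z) 0 i) ?coord_le_norm// !mxE.
  by rewrite opprD addrACA subrr addr0.
exact: continuous_mul.
Qed.

Lemma continuous_excess_dist x a :
  continuous (fun z : 'rV[R]_n => Num.max (`|x - z| - a) 0).
Proof.
apply: (@lipschitz_continuous _ 1) => y z; rewrite mul1r.
apply: (@le_trans _ _ (`| `|x - y| - `|x - z| |)).
  have := ler_norm (`|x - y| - `|x - z|); have := ler_norm (`|x - z| - `|x - y|).
  rewrite (distrC `|x - z|) ler_norml /Num.max; do 2!case: ifPn; lra.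
apply: le_trans (ler_dist_dist _ _) _.
by rewrite opprB addrC subrKA distrC.
Qed.

Lemma compact_min (f : 'rV[R]_n -> R) (A : set 'rV[R]_n) :
  A !=set0 -> compact A -> continuous f ->
  exists2 c, A c & forall t, A t -> f c <= f t.
Proof.
move=> A0 cA cf.
have [|c] := compact_EVT_min A0 cA (f := f).
  exact: continuous_subspaceT.
by rewrite inE => Ac cmin; exists c => // t At; apply: cmin; rewrite inE.
Qed.

End SupNorm.

(** * Uniform bounds on multipliers *)

(** The constant is the minimum of [f] on the unit sphere.  This one compactness
    argument gives both the equivalence of norms and the bounds on multipliers. *)
Lemma homogeneous_lower_bound (R : realType) (k : nat) (f : 'rV[R]_k -> R) :
  continuous f -> (forall a v, 0 <= a -> f (a *: v) = a * f v) ->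
  (forall v, v != 0 -> 0 < f v) ->
  exists2 m, 0 < m & forall v, m * `|v| <= f v.
Proof.
move=> cf fZ f0.
have f00 : f 0 = 0 by rewrite -[0 in LHS](scale0r 0) fZ// mul0r.
have [K0|K0] := pselect ([set v : 'rV[R]_k | `|v| = 1] !=set0); last first.
  exists 1 => // v; have [->|v0] := eqVneq v 0; first by rewrite normr0 mulr0 f00.
  exfalso; apply: K0; exists (`|v|^-1 *: v) => /=.
  by rewrite normrZ ger0_norm ?invr_ge0// mulVf// normr_eq0.
have cK : compact [set v : 'rV[R]_k | `|v| = 1].
  apply: (subclosed_compact _ (@closed_ball_compact R k 0 1)).
    have /continuous_closedP /(_ _ (@closed_eq R 1)) // :
        continuous (fun v : 'rV[R]_k => `|v|).
    apply: (@lipschitz_continuous _ _ _ 1) => x y; rewrite mul1r.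
    exact: ler_dist_dist.
  by move=> v /= v1; rewrite subr0 v1.
have [c /= c1 cmin] := compact_min K0 cK cf.
exists (f c); first by apply: f0; rewrite -normr_eq0 c1 oner_eq0.
move=> v; have [->|v0] := eqVneq v 0; first by rewrite normr0 mulr0 f00.
have nv : 0 < `|v| by rewrite normr_gt0.
have := cmin (`|v|^-1 *: v).
rewrite /= normrZ ger0_norm ?invr_ge0// mulVf ?normr_eq0// => /(_ erefl).
by rewrite fZ ?invr_ge0// ler_pdivlMl// mulrC.
Qed.

Section Multipliers.
Variables (R : realType) (n : nat) (T : finType).
Variables (G : T -> 'rV[R]_n -> 'rV[R]_n) (xs : 'rV[R]_n).
Implicit Types (A K J C : {set T}) (lam mu : T -> R) (u : 'rV[R]_n).

Definition comb A lam u := \sum_(t in A) lam t *: G t u.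

Definition indep A u := forall lam, comb A lam u = 0 -> {in A, forall t, lam t = 0}.

Definition nonneg_on A lam := {in A, forall t, 0 <= lam t}.

Hypothesis contG : forall t e, 0 < e -> \forall u \near xs, `|G t u - G t xs| <= e.

(** Injectivity of the combination on a closed cone at [xs] is an open condition
    with a uniform constant.  It is quantified by the homogeneous function [f],
    which adds to the norm of the combination two penalties: the negative parts
    of the sign-constrained coefficients and the coefficients outside [A].  Thus
    [f] vanishes only at 0, no closedness of the cone has to be discussed, and
    the gradients at nearby points are a perturbation by half of the minimum. *)
Lemma multiplier_bound A C :
  (forall lam, nonneg_on (A :&: C) lam -> comb A lam xs = 0 ->
    {in A, forall t, lam t = 0}) ->
  exists2 M, 0 < M & \forall u \near xs, forall lam, nonneg_on (A :&: C) lam ->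
    {in A, forall t, `|lam t| <= M * `|comb A lam u|}.
Proof.
move=> inj.
pose ext (v : 'rV[R]_#|T|) t := v 0 (enum_rank t).
pose f v := `|comb A (ext v) xs| + \sum_(t in A :&: C) Num.max (- ext v t) 0
            + \sum_(t in ~: A) `|ext v t|.
have ext_le v t : `|ext v t| <= `|v| by exact: coord_le_norm.
have fZ a v : 0 <= a -> f (a *: v) = a * f v.
  move=> a0; have extZ t : ext (a *: v) t = a * ext v t by rewrite /ext mxE.
  rewrite /f !mulrDr; congr (_ + _ + _).
  - rewrite /comb -{2}(ger0_norm a0) -normrZ scaler_sumr.
    by under eq_bigr do rewrite extZ -scalerA.
  - rewrite mulr_sumr; apply: eq_bigr => t _.
    by rewrite extZ -mulrN -{1}(mulr0 a) maxr_pMr.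
  - by rewrite mulr_sumr; apply: eq_bigr => t _; rewrite extZ normrM ger0_norm.
have fpos v : v != 0 -> 0 < f v.
  apply: contraNT; rewrite -leNgt => fv.
  have s1 : 0 <= \sum_(t in A :&: C) Num.max (- ext v t) 0.
    by apply: sumr_ge0 => t _; rewrite le_max lexx orbT.
  have s2 : 0 <= \sum_(t in ~: A) `|ext v t| by apply: sumr_ge0.
  have nc := normr_ge0 (comb A (ext v) xs).
  have e1 : `|comb A (ext v) xs| = 0 by move: fv; rewrite /f; lra.
  have e2 : \sum_(t in A :&: C) Num.max (- ext v t) 0 = 0.
    by move: fv; rewrite /f; lra.
  have e3 : \sum_(t in ~: A) `|ext v t| = 0 by move: fv; rewrite /f; lra.
  have ext0 t : ext v t = 0.
    have [tA|tA] := boolP (t \in A); last first.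
      have tA' : t \in ~: A by rewrite inE.
      have H0 s : s \in ~: A -> 0 <= `|ext v s| by [].
      exact/normr0_eq0/(psumr_eq0P H0 e3).
    apply: inj tA; last exact/normr0_eq0.
    move=> s sAC.
    have H0 t' : t' \in A :&: C -> 0 <= Num.max (- ext v t') 0.
      by rewrite le_max lexx orbT.
    have := psumr_eq0P H0 e2 sAC => H.
    have : - ext v s <= 0 by rewrite -H le_max lexx.
    by rewrite oppr_le0.
  apply/eqP/rowP => j; rewrite mxE.
  by have := ext0 (enum_val j); rewrite /ext enum_valK.
pose L := \sum_(t in A) `|G t xs| + #|A :&: C|%:R + #|~: A|%:R.
have fL v w : `|f v - f w| <= L * `|v - w|.
  have extB t : ext v t - ext w t = ext (v - w) t by rewrite /ext !mxE.
  rewrite /f /L !mulrDl.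
  rewrite (_ : _ + _ - _ = (`|comb A (ext v) xs| - `|comb A (ext w) xs|) +
    (\sum_(t in A :&: C) Num.max (- ext v t) 0
     - \sum_(t in A :&: C) Num.max (- ext w t) 0) +
     (\sum_(t in ~: A) `|ext v t| - \sum_(t in ~: A) `|ext w t|)); last by ring.
  apply: le_trans (ler_normD _ _) _; apply: lerD.
    apply: le_trans (ler_normD _ _) _; apply: lerD.
      apply: le_trans (ler_dist_dist _ _) _.
      rewrite /comb -sumrB mulr_suml.
      apply: le_trans (ler_norm_sum _ _ _) _; apply: ler_sum => t _.
      by rewrite -scalerBl extB normrZ mulrC ler_wpM2l.
    rewrite -sumrB; apply: le_trans (ler_norm_sum _ _ _) _.
    rewrite -sum1_card natr_sum mulr_suml; apply: ler_sum => t _.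
    rewrite mul1r; apply: le_trans (ext_le _ t); rewrite -extB.
    have := ler_norm (ext v t - ext w t).
    have := ler_norm (ext w t - ext v t); rewrite distrC.
    by rewrite ler_norml /Num.max; do 2!case: ifPn; lra.
  rewrite -sumrB; apply: le_trans (ler_norm_sum _ _ _) _.
  rewrite -sum1_card natr_sum mulr_suml; apply: ler_sum => t _.
  rewrite mul1r; apply: le_trans (ext_le _ t); rewrite -extB.
  exact: ler_dist_dist.
have [m m0 mf] := homogeneous_lower_bound (lipschitz_continuous fL) fZ fpos.
pose N : R := #|A|%:R + 1.
have N0 : 0 < N by rewrite ltr_wpDl.
exists (2 / m); first by rewrite divr_gt0.
have e0 : 0 < m / (2 * N) by rewrite divr_gt0// mulr_gt0.
have : \forall u \near xs, forall t, `|G t u - G t xs| <= m / (2 * N).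
  by apply: near_forall => t; exact: contG.
move=> /near_sub; apply => u Gu lam lam0 t tA.
pose v : 'rV[R]_#|T| := \row_j (if enum_val j \in A then lam (enum_val j) else 0).
have extv s : ext v s = if s \in A then lam s else 0.
  by rewrite /ext mxE enum_rankK.
have fv : f v = `|comb A lam xs|.
  rewrite /f big1 ?addr0; last first.
    move=> s; rewrite inE extv => /andP[sA sC]; rewrite sA max_r// oppr_le0.
    by apply: lam0; rewrite inE sA.
  rewrite big1 ?addr0; last first.
    by move=> s; rewrite inE extv => /negPf ->; rewrite normr0.
  by congr `| _ |; apply: eq_bigr => s sA; rewrite extv sA.
have lamv s : s \in A -> `|lam s| <= `|v|.
  by move=> sA; have := ext_le v s; rewrite extv sA.
have diff : `|comb A lam xs - comb A lam u| <= m / 2 * `|v|.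
  rewrite /comb -sumrB; apply: le_trans (ler_norm_sum _ _ _) _.
  apply: (@le_trans _ _ (\sum_(s in A) `|v| * (m / (2 * N)))).
    apply: ler_sum => s sA; rewrite -scalerBr normrZ ler_pM ?lamv//.
    by rewrite distrC.
  rewrite sumr_const -(mulr_natr _ #|A|).
  apply: (@le_trans _ _ (`|v| * (m / (2 * N)) * N)).
    by rewrite ler_wpM2l ?lerDl// mulr_ge0// ltW.
  by rewrite le_eqVlt; apply/orP; left; apply/eqP; field; rewrite gt_eqF.
have := mf v; rewrite fv => mv.
have := ler_distD (comb A lam u) (comb A lam xs) 0; rewrite !subr0 => tri.
apply: le_trans (lamv t tA) _.
rewrite mulrAC ler_pdivlMr// mulrC.
by move: diff mv tri; lra.
Qed.

End Multipliers.

(** * First-order upper models *)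
Section UpperGradient.
Variables (R : realType) (n : nat).
Implicit Types (f : 'rV[R]_n -> R) (g x z h : 'rV[R]_n).

(** One-sided differentiability from above: it is all that a local minimum needs,
    and it holds for squared positive parts without any case distinction on the
    derivative. *)
Definition upper_gradient f g z := forall e, 0 < e ->
  \forall w \near z, f w - f z <= dotp g (w - z) + e * `|w - z|.

Lemma upper_gradientD f1 f2 g1 g2 z :
  upper_gradient f1 g1 z -> upper_gradient f2 g2 z ->
  upper_gradient (fun w => f1 w + f2 w) (g1 + g2) z.
Proof.
move=> u1 u2 e e0; have e2 : 0 < e / 2 by rewrite divr_gt0.
have /near_sub := (near_and (u1 _ e2) (u2 _ e2)); apply => w [].
rewrite dotpDl; lra.
Qed.

Lemma upper_gradientZ a f g z : 0 <= a ->
  upper_gradient f g z -> upper_gradient (fun w => a * f w) (a *: g) z.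
Proof.
move=> a0 u e e0; have e1 : 0 < e / (a + 1) by rewrite divr_gt0// ltr_wpDl.
have /near_sub := (u _ e1); apply => w; rewrite dotpZl -mulrBr => fw.
apply: le_trans (ler_wpM2l a0 fw) _; rewrite mulrDr lerD2l mulrA ler_wpM2r//.
by rewrite mulrCA ler_piMr ?(ltW e0)// ler_pdivrMr ?mul1r ?lerDl// ltr_wpDl.
Qed.

Lemma upper_gradient0 z : upper_gradient (fun=> 0) 0 z.
Proof.
move=> e e0; apply: near_all => w; rewrite subrr dotp0l add0r.
by rewrite mulr_ge0// ltW.
Qed.

Lemma upper_gradient_sum (T : finType) (f : T -> 'rV[R]_n -> R)
    (g : T -> 'rV[R]_n) z :
  (forall t, upper_gradient (f t) (g t) z) ->
  upper_gradient (fun w => \sum_t f t w) (\sum_t g t) z.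
Proof.
move=> fg; elim: (index_enum T) => [|t s IHs].
  by under eq_fun do rewrite big_nil; rewrite big_nil; exact: upper_gradient0.
by under eq_fun do rewrite big_cons; rewrite big_cons; exact: upper_gradientD.
Qed.

Lemma upper_gradient_min f g z :
  upper_gradient f g z -> (\forall w \near z, f z <= f w) -> g = 0.
Proof.
move=> ug fmin; apply/eqP/negP => /negP g0.
have ng : 0 < `|g| by rewrite normr_gt0.
have e0 : 0 < `|g| / 2 by rewrite divr_gt0.
have [d d0 dP] := (near_ballP _ _).1 (near_and fmin (ug _ e0)).
pose s := d / (2 * `|g|).
have s0 : 0 < s by rewrite divr_gt0// mulr_gt0.
have wz : z - s *: g - z = - (s *: g) by rewrite addrC addKr.
have nw : `|z - s *: g - z| = s * `|g|.
  by rewrite wz normrN normrZ gtr0_norm.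
have wd : `|z - s *: g - z| < d.
  rewrite nw /s (_ : _ * _ = d / 2); first lra.
  by field; rewrite gt_eqF.
have [f1 f2] := dP _ wd.
move: f2; rewrite nw wz dotpNr dotpZr => f2.
have g2 := norm_sqr_le_dotp g.
have : s * `|g| ^+ 2 <= s * dotp g g by rewrite ler_pM2l.
have : 0 < s * `|g| ^+ 2 by rewrite mulr_gt0// exprn_gt0.
rewrite (_ : `|g| / 2 * (s * `|g|) = s * `|g| ^+ 2 / 2) in f2; last by field.
lra.
Qed.

Lemma upper_gradient_dist x z :
  upper_gradient (fun w => dotp (w - x) (w - x)) (2 *: (z - x)) z.
Proof.
move=> e e0; apply/near_ballP; exists (e / (n%:R + 1)).
  by rewrite divr_gt0// ltr_wpDl.
move=> w wz.
have -> : w - x = (z - x) + (w - z) by rewrite [RHS]addrC subrKA.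
move: (z - x) (w - z) wz => a b bn.
rewrite dotpDl !dotpDr dotpZl (dotpC b a).
have := dotp_norm_le b b.
have : n%:R * `|b| * `|b| <= e * `|b|.
  rewrite ler_wpM2r//; move: bn; rewrite ltr_pdivlMr ?ltr_wpDl// => bn.
  by have := normr_ge0 b; move: bn; lra.
have := ler_norm (dotp b b).
lra.
Qed.

End UpperGradient.

(** * Error bound for scalar constraints *)

(** [C] indexes the inequalities and its complement the equations; [H] indexes the
    equations of constant rank, which enter the condition [rcpld] only through
    a basis [J] of their gradients. *)
Section ErrorBound.
Variables (R : realType) (n : nat) (T : finType).
Variables (c : T -> 'rV[R]_n -> R) (G : T -> 'rV[R]_n -> 'rV[R]_n).
Variables (C H J : {set T}) (xs : 'rV[R]_n).
Implicit Types (A K : {set T}) (lam mu : T -> R) (u x z : 'rV[R]_n).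

Hypothesis strict_diff : forall t z e, 0 < e -> exists2 d, 0 < d &
  forall x y, `|x - z| < d -> `|y - z| < d ->
    `|c t x - c t y - dotp (G t z) (x - y)| <= e * `|x - y|.
Hypothesis contG :
  forall t e, 0 < e -> \forall u \near xs, `|G t u - G t xs| <= e.
Hypothesis xs_le0 : forall t, t \in C -> c t xs <= 0.
Hypothesis xs_eq0 : forall t, t \notin C -> c t xs = 0.
Hypothesis JH : J \subset H.
Hypothesis CH : {in C, forall t, t \notin H}.
Hypothesis indepJ : indep G J xs.
Hypothesis spanH : \forall u \near xs, forall t, t \in H ->
  exists mu, G t u = comb G J mu u.
Hypothesis rcpld : forall K, K \subset ~: H ->
  {in K :&: C, forall t, c t xs = 0} ->
  forall lam, nonneg_on (K :&: C) lam -> comb G (K :|: J) lam xs = 0 ->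
  (exists2 t, t \in K :|: J & lam t != 0) ->
  \forall u \near xs, u != xs -> ~ indep G (K :|: J) u.

(** Subtract the multiple of a linear relation that first annihilates a
    coefficient in [A].  Choosing the index of smallest ratio |lam| / |a| leaves
    all signs unchanged, and the relation must involve [A] because the basis [J]
    is independent; [J] is therefore never reduced. *)
Lemma caratheodory A lam u :
  indep G J u -> A \subset ~: H -> nonneg_on (A :&: C) lam ->
  exists A' lam', [/\ A' \subset A, nonneg_on (A' :&: C) lam',
    comb G (A' :|: J) lam' u = comb G (A :|: J) lam u
    & indep G (A' :|: J) u].
Proof.
move=> iJ; have [k] := ubnP #|A|; elim: k => // k IHk in A lam *.
rewrite ltnS => Ak AH lam0.
have [iAJ|] := pselect (indep G (A :|: J) u); first by exists A, lam.
move=> /existsNP[a] /not_implyP[ca0] /existsNP[t] /not_implyP[tAJ] /eqP at0.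
have [t1 /andP[t1A at1]] : exists t, (t \in A) && (a t != 0).
  apply: contrapT => noA; move: tAJ; rewrite inE => /orP[tA|tJ].
    by apply: noA; exists t; rewrite tA.
  have aA s : s \in A -> a s = 0.
    by move=> sA; apply/eqP/negPn/negP => as0; apply: noA; exists s; rewrite sA.
  move/negP: at0; apply; apply/eqP; apply: iJ tJ; rewrite -ca0 /comb.
  rewrite [RHS](bigID (mem J))/= [X in _ + X]big1 ?addr0; last first.
    by move=> s; rewrite inE => /andP[/orP[/aA->|->//]]; rewrite scale0r.
  by apply: eq_bigl => s; rewrite inE; case: (s \in J); rewrite ?orbT ?andbF.
pose P s := (s \in A) && (a s != 0).
have [t0 /andP[t0A at00] t0min] :=
  @arg_minP _ R T t1 P (fun s => `|lam s| / `|a s|) (introT andP (conj t1A at1)).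
pose lam' s := lam s - lam t0 / a t0 * a s.
have lamt0 : lam' t0 = 0 by rewrite /lam' divfK// subrr.
have t0J : t0 \notin J.
  apply/negP => /(fintype.subsetP JH) t0H.
  by move/fintype.subsetP: AH => /(_ _ t0A); rewrite inE t0H.
have e : comb G (A :\ t0 :|: J) lam' u = comb G (A :|: J) lam u.
  transitivity (comb G (A :|: J) lam' u).
    rewrite /comb [RHS](bigD1 t0)/= ?inE ?t0A// lamt0 scale0r add0r.
    apply: eq_bigl => s; rewrite !inE; have [->|] := eqVneq s t0 => /=.
      by rewrite (negPf t0J) andbF.
    by rewrite andbT.
  rewrite /comb; under eq_bigr do rewrite scalerBl -scalerA.
  by rewrite sumrB -scaler_sumr -/(comb _ _ a u) ca0 scaler0 subr0.
have [|||A' [lam'' [A'A lam''0 e' i']]] := IHk (A :\ t0) lam' _ _ _.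
- by apply: leq_trans Ak; rewrite (cardsD1 t0 A) t0A.
- by apply: fintype.subset_trans AH; rewrite finset.subD1set.
- move=> s; rewrite !inE => /andP[/andP[_ sA] sC].
  have ls : 0 <= lam s by apply: lam0; rewrite inE sA.
  rewrite /lam' subr_ge0; have [->|as0] := eqVneq (a s) 0; first by rewrite mulr0.
  have := t0min s; rewrite /P sA as0 => /(_ isT) le.
  apply: le_trans (ler_norm _) _; rewrite normrM normf_div.
  by rewrite -ler_pdivlMr ?normr_gt0// -(ger0_norm ls).
exists A', lam''; split => //; last by rewrite e'.
by apply: fintype.subset_trans A'A _; rewrite finset.subD1set.
Qed.

Lemma indepJ_near : \forall u \near xs, indep G J u.
Proof.
have [|M M0 MP] := @multiplier_bound _ _ _ G xs contG J finset.set0.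
  by move=> lam _ l0; exact: indepJ.
have /near_sub := MP; apply => u uP lam l0 t tJ; apply/normr0_eq0/eqP.
rewrite eq_le normr_ge0 andbT.
apply: le_trans (uP lam _ t tJ) _; last by rewrite l0 normr0 mulr0.
by move=> s; rewrite !inE andbF.
Qed.

(** For each of the finitely many index sets there are two cases: either no
    admissible combination vanishes at [xs], and the weights are bounded by
    compactness, or one does, and then [rcpld] says that the family is not
    independent near [xs]. *)
Lemma reduced_multiplier_bound : exists2 M, 0 < M &
  \forall u \near xs, u != xs -> forall K, K \subset ~: H ->
    {in K :&: C, forall t, c t xs = 0} -> indep G (K :|: J) u ->
    forall lam, nonneg_on (K :&: C) lam ->
    {in K :|: J, forall t, `|lam t| <= M * `|comb G (K :|: J) lam u|}.
Proof.
have bound K : exists M, 0 < M /\ \forall u \near xs,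
    u != xs -> K \subset ~: H ->
    {in K :&: C, forall t, c t xs = 0} -> indep G (K :|: J) u ->
    forall lam, nonneg_on (K :&: C) lam ->
    {in K :|: J, forall t, `|lam t| <= M * `|comb G (K :|: J) lam u|}.
  have [KH|nKH] := boolP (K \subset ~: H); last first.
    by exists 1; split => //; apply: near_all => u _.
  have [Kact|nKact] := pselect {in K :&: C, forall t, c t xs = 0}; last first.
    by exists 1; split => //; apply: near_all => u _ _ /nKact.
  have KJC : (K :|: J) :&: C = K :&: C.
    apply/finset.setP => t; rewrite !inE; case: (boolP (t \in C)) => tC; rewrite ?andbF//.
    rewrite !andbT; case: (boolP (t \in J)) => [/(fintype.subsetP JH) tH|_]; last first.
      by rewrite orbF.
    by rewrite (negPf (CH tC)) in tH.
  have [inj|] := pselect (forall lam, nonneg_on ((K :|: J) :&: C) lam ->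
      comb G (K :|: J) lam xs = 0 -> {in K :|: J, forall t, lam t = 0}).
    have [M M0 MP] := multiplier_bound contG inj.
    exists M; split => //; have /near_sub := MP; apply => u uP _ _ _ _ lam lam0.
    by apply: uP; rewrite KJC.
  move=> /existsNP[lam] /not_implyP[lam0] /not_implyP[cl0] /existsNP[t].
  move=> /not_implyP[tKJ] /eqP lt0; rewrite KJC in lam0.
  exists 1; split => //.
  have /near_sub := rcpld KH Kact lam0 cl0 (ex_intro2 _ _ t tKJ lt0); apply.
  by move=> u nu /nu nind _ _ /nind.
have [M MP] := choice bound.
exists (\sum_K M K + 1).
  by rewrite ltr_wpDl// sumr_ge0// => K _; rewrite ltW// (MP K).1.
have : \forall u \near xs, forall K : {set T},
    u != xs -> K \subset ~: H ->
    {in K :&: C, forall t, c t xs = 0} -> indep G (K :|: J) u ->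
    forall lam, nonneg_on (K :&: C) lam ->
    {in K :|: J, forall t, `|lam t| <= M K * `|comb G (K :|: J) lam u|}.
  by apply: near_forall => K; exact: (MP K).2.
move=> /near_sub; apply => u uP uxs K KH Kact iK lam lam0 t tK.
apply: le_trans (uP K uxs KH Kact iK lam lam0 t tK) _.
rewrite ler_wpM2r// (bigD1 K)//= -addrA lerDl addr_ge0// sumr_ge0// => K' _.
by rewrite ltW// (MP K').1.
Qed.

Definition violation t z := if t \in C then Num.max (c t z) 0 else c t z.

(** The linear term may be taken at the point [z] instead of [xs] because the
    gradients are continuous at [xs]. *)
Lemma uniform_strict_diff e : 0 < e -> exists2 d, 0 < d &
  forall t x z, `|x - xs| < d -> `|z - xs| < d ->
    `|c t x - c t z - dotp (G t z) (x - z)| <= e * `|x - z|.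
Proof.
move=> e0; have e2 : 0 < e / 2 by rewrite divr_gt0.
have n1 : 0 < n%:R + 1 :> R by rewrite ltr_wpDl.
have en : 0 < e / 2 / (n%:R + 1) by rewrite divr_gt0.
have dt t : exists d, 0 < d /\ forall x z, `|x - xs| < d -> `|z - xs| < d ->
    `|c t x - c t z - dotp (G t z) (x - z)| <= e * `|x - z|.
  have [d1 d10 d1P] := strict_diff t xs e2.
  have [d2 d20 d2P] := (near_ballP _ _).1 (contG t en).
  exists (Num.min d1 d2); rewrite lt_min d10 d20; split => // x z.
  rewrite !lt_min => /andP[x1 x2] /andP[z1 z2].
  rewrite (_ : _ - _ - _ = (c t x - c t z - dotp (G t xs) (x - z))
                           + dotp (G t xs - G t z) (x - z)); last first.
    by rewrite dotpBl; ring.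
  apply: le_trans (ler_normD _ _) _.
  have := d1P x z x1 z1.
  suff : `|dotp (G t xs - G t z) (x - z)| <= e / 2 * `|x - z| by lra.
  apply: le_trans (dotp_norm_le _ _) _; rewrite ler_wpM2r//.
  have := d2P z z2; rewrite distrC => Gz.
  apply: (@le_trans _ _ ((n%:R + 1) * `|G t xs - G t z|)).
    by rewrite ler_wpM2r// lerDl.
  by rewrite mulrC -ler_pdivlMr.
have [d dP] := choice dt.
exists (\big[Num.min/1]_t d t).
  by apply/bigmin_gtP; split => // t _; exact: (dP t).1.
move=> t x z xd zd; apply: (dP t).2.
  by apply: lt_le_trans xd _; exact: bigmin_le_cond.
by apply: lt_le_trans zd _; exact: bigmin_le_cond.
Qed.

Lemma local_lipschitz t z : exists2 L, 0 < L &
  \forall w \near z, `|c t w - c t z| <= L * `|w - z|.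
Proof.
have [d d0 dP] := strict_diff t z ltr01.
exists (n%:R * `|G t z| + 1); first by rewrite ltr_wpDl// mulr_ge0.
apply/near_ballP; exists d => // w wz.
have := dP w z wz; rewrite subrr normr0 => /(_ d0).
have := dotp_norm_le (G t z) (w - z).
have := ler_normD (c t w - c t z - dotp (G t z) (w - z)) (dotp (G t z) (w - z)).
rewrite subrK; lra.
Qed.

Lemma continuous_violation t : continuous (violation t).
Proof.
have vc w z : `|violation t w - violation t z| <= `|c t w - c t z|.
  rewrite /violation; case: ifP => // _.
  have := ler_norm (c t w - c t z); have := ler_norm (c t z - c t w).
  rewrite (distrC (c t z)) ler_norml /Num.max; do 2!case: ifPn; lra.
move=> z; apply/(@cvgrPdist_le _ _ _ (nbhs z)) => e e0.
have [L L0 LP] := local_lipschitz t z.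
have [d d0 dP] := (near_ballP _ _).1 LP.
apply/near_ballP; exists (Num.min d (e / L)).
  by rewrite lt_min d0 divr_gt0.
move=> w; rewrite lt_min => /andP[wd we].
rewrite distrC; apply: le_trans (vc _ _) _; apply: le_trans (dP w wd) _.
by rewrite mulrC -ler_pdivlMr// ltW.
Qed.

(** Both kinds of constraint reduce to the square of [v + (c t w - c t z)]: for an
    inequality the positive part only decreases that square. *)
Lemma upper_gradient_sqr_violation t z :
  upper_gradient (fun w => violation t w ^+ 2) ((2 * violation t z) *: G t z) z.
Proof.
move=> e e0; set v := violation t z.
have v1 : 0 < 4 * (`|v| + 1) by rewrite mulr_gt0// ltr_wpDl.
have [d d0 dP] := strict_diff t z (divr_gt0 e0 v1).
have [L L0 LP] := local_lipschitz t z.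
have [d' d'0 d'P] := (near_ballP _ _).1 LP.
have L2 : 0 < 2 * L ^+ 2 by rewrite mulr_gt0// exprn_gt0.
apply/near_ballP; exists (Num.min (Num.min d d') (e / (2 * L ^+ 2))).
  by rewrite !lt_min d0 d'0 divr_gt0.
move=> w; rewrite !lt_min => /andP[/andP[wd wd'] we].
have sq : violation t w ^+ 2 <= (v + (c t w - c t z)) ^+ 2.
  rewrite /v /violation; case: ifPn => _; last by rewrite addrC subrK.
  have [cw|cw] := leP (c t w) 0; first by rewrite expr0n/= sqr_ge0.
  have [cz|cz] := leP (c t z) 0; last by rewrite addrC subrK.
  rewrite add0r lerXn2r// ?nnegrE; lra.
apply: le_trans (_ : 2 * v * (c t w - c t z) + (c t w - c t z) ^+ 2 <= _).
  by move: sq; rewrite sqrrD; lra.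
have := dP w z wd; rewrite subrr normr0 => /(_ d0) D.
have {}d'P := d'P w wd'.
have sq2 : (c t w - c t z) ^+ 2 <= e / 2 * `|w - z|.
  rewrite -real_normK ?num_real//.
  apply: (@le_trans _ _ ((L * `|w - z|) ^+ 2)).
    by rewrite lerXn2r ?nnegrE// mulr_ge0// ltW.
  rewrite exprMn [X in _ * X]expr2 mulrA ler_wpM2r//.
  by move: we; rewrite ltr_pdivlMr// mulrC; lra.
have cross : 2 * v * (c t w - c t z - dotp (G t z) (w - z)) <= e / 2 * `|w - z|.
  apply: le_trans (ler_norm _) _; rewrite normrM.
  apply: (@le_trans _ _ (2 * (`|v| + 1) * (e / (4 * (`|v| + 1)) * `|w - z|))).
    rewrite ler_pM// normrM ger0_norm// ler_wpM2l// lerDl//.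
  rewrite le_eqVlt; apply/orP; left; apply/eqP; field.
  by rewrite gt_eqF// ltr_wpDl.
rewrite dotpZl; lra.
Qed.

Definition penalty j x z := dotp (z - x) (z - x) + j * \sum_t violation t z ^+ 2.

Lemma penalty_stationary j x z : 0 <= j ->
  (\forall w \near z, penalty j x z <= penalty j x w) ->
  x - z = \sum_t (j * violation t z) *: G t z.
Proof.
move=> j0 pmin.
have ug : upper_gradient (penalty j x)
    (2 *: (z - x) + j *: \sum_t (2 * violation t z) *: G t z) z.
  apply: upper_gradientD; first exact: upper_gradient_dist.
  apply: upper_gradientZ => //.
  by apply: upper_gradient_sum => t; exact: upper_gradient_sqr_violation.
have := upper_gradient_min ug pmin.
rewrite (_ : j *: _ = 2 *: \sum_t (j * violation t z) *: G t z); last first.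
  rewrite !scaler_sumr; apply: eq_bigr => t _; rewrite !scalerA.
  by congr (_ *: _); ring.
rewrite -scalerDr => /eqP; rewrite scaler_eq0 pnatr_eq0/= addr_eq0 => /eqP zx.
by rewrite -[RHS]opprK -zx opprB.
Qed.

(** Pairing x - z with itself: each reduced weight is at most M |x - z|, and
    each gradient paired with x - z is c t x - c t z up to e |x - z|.  For an
    inequality the weight is nonnegative and c t z is positive, so c t z can be
    dropped; the constant [e] makes the total error term at most half of
    |x - z|^2. *)
Lemma stationary_distance : exists M d, [/\ 0 < M, 0 < d & forall x z mu,
  `|x - xs| < d -> `|z - xs| < d ->
  (forall t, t \in C -> 0 <= mu t) -> (forall t, mu t != 0 -> violation t z != 0) ->
  x - z = \sum_t mu t *: G t z ->
  `|x - z| <= M * (\sum_t `|violation t x| + \sum_t `|violation t z|)].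
Proof.
have [M M0 MP] := reduced_multiplier_bound.
pose e := 1 / (2 * (#|T|%:R * M + 1)).
have TM : 0 < #|T|%:R * M + 1 by rewrite ltr_wpDl// mulr_ge0// ltW.
have e0 : 0 < e by rewrite divr_gt0// mulr_gt0.
have [d1 d10 d1P] := uniform_strict_diff e0.
(* An inequality that is violated at z is active at xs; this makes the family
   admissible for the condition [rcpld]. *)
have inactive : \forall z \near xs, forall t, c t xs < 0 -> c t z <= 0.
  apply: near_forall => t.
  have [ct|ct] := ltP (c t xs) 0; last by apply: near_all.
  have [L L0 /near_ballP[d d0 dP]] := local_lipschitz t xs.
  apply/near_ballP; exists (Num.min d (- c t xs / L)).
    by rewrite lt_min d0 divr_gt0// oppr_gt0.
  move=> z; rewrite lt_min ltr_pdivlMr// => /andP[zd zL] _.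
  have := dP z zd; have := ler_norm (c t z - c t xs); lra.
have [d2 d20 d2P] := (near_ballP _ _).1
  (near_and (near_and MP spanH) (near_and indepJ_near inactive)).
exists (2 * M), (Num.min d1 d2); split.
- by rewrite mulr_gt0.
- by rewrite lt_min d10 d20.
move=> x z mu; rewrite !lt_min => /andP[x1 x2] /andP[z1 z2] mu0 muv xz.
have {d2P}[[{}MP {}spanH'] [iJ {}inactive]] := d2P z z2.
have [zxs|zxs] := eqVneq z xs.
  have mu00 t : mu t = 0.
    apply/eqP/negPn/negP => /muv; rewrite zxs /violation; case: ifPn => tC.
      by rewrite max_r ?eqxx// xs_le0.
    by rewrite xs_eq0 ?eqxx.
  rewrite xz big1 ?normr0; last by move=> t _; rewrite mu00 scale0r.
  by rewrite !mulr_ge0 ?(ltW M0)// addr_ge0// sumr_ge0.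
have [nu nuP] : {nu : T -> T -> R &
    forall t, t \in H -> G t z = comb G J (nu t) z}.
  apply: (@choice _ _ (fun t nu => t \in H -> G t z = comb G J nu z)).
  move=> t; have [/spanH'[nu nuP]|tH] := boolP (t \in H); first by exists nu.
  by exists (fun=> 0).
(* The weights of the equations in H are moved onto the basis J. *)
pose A := [set t | (t \notin H) && (mu t != 0)]%SET.
pose lam s := if s \in J then \sum_(t in H) mu t * nu t s else mu s.
have AH : A \subset ~: H.
  by apply/fintype.subsetP => t; rewrite !inE => /andP[].
have AJ s : s \in A -> s \notin J.
  by rewrite inE => /andP[sH _]; apply: contra sH; exact: (fintype.subsetP JH).
have cAJ : comb G (A :|: J) lam z = x - z.
  rewrite xz /comb (bigID (mem J))/= [RHS](bigID (mem H))/=; congr (_ + _).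
    rewrite [RHS](_ : _ = \sum_(t in H) \sum_(s in J) (mu t * nu t s) *: G s z).
      rewrite exchange_big/=; apply: eq_big => [s|s /andP[_ sJ]].
        by rewrite inE; case: (s \in J); rewrite ?orbT ?andbF.
      by rewrite /lam sJ scaler_suml.
    apply: eq_bigr => t tH; rewrite {1}(nuP t tH) /comb scaler_sumr.
    by apply: eq_bigr => s _; rewrite scalerA.
  rewrite [RHS](bigID (fun t => mu t == 0))/= [X in _ = X + _]big1 ?add0r; last first.
    by move=> t /andP[_ /eqP ->]; rewrite scale0r.
  apply: eq_big => [s|s /andP[_ sJ]]; last by rewrite /lam (negPf sJ).
  rewrite !inE; case: (boolP (s \in J)) => [/(fintype.subsetP JH) ->|sJ] /=.
    by rewrite ?andbF.
  by rewrite orbF andbT.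
have lam0 : nonneg_on (A :&: C) lam.
  by move=> t; rewrite finset.in_setI => /andP[tA tC]; rewrite /lam (negPf (AJ t tA)) mu0.
have [A' [lam' [A'A lam'0 cA'J iA'J]]] := caratheodory iJ AH lam0.
have cpos t : t \in A' :&: C -> 0 < c t z.
  rewrite finset.in_setI => /andP[/(fintype.subsetP A'A) tA tC].
  have : mu t != 0 by move: tA; rewrite inE => /andP[].
  move=> /muv; rewrite /violation tC; case: (ltP 0 (c t z)) => //.
  by rewrite eqxx.
have act : {in A' :&: C, forall t, c t xs = 0}.
  move=> t tA'; apply/eqP; move: (tA'); rewrite finset.in_setI => /andP[_ tC].
  rewrite eq_le xs_le0//= leNgt; apply/negP => /inactive.
  by rewrite leNgt cpos.
have lamM := MP zxs A' (fintype.subset_trans A'A AH) act iA'J lam' lam'0.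
rewrite cA'J cAJ in lamM.
pose r t := `|violation t x| + `|violation t z| + e * `|x - z|.
have r0 t : 0 <= r t by rewrite /r !addr_ge0// mulr_ge0// ltW.
have term t : t \in A' :|: J ->
    lam' t * dotp (G t z) (x - z) <= M * `|x - z| * r t.
  move=> tAJ; have D := d1P t x z x1 z1.
  have [tC|tC] := boolP (t \in C).
    have tA' : t \in A'.
      move: tAJ; rewrite inE => /orP[//|/(fintype.subsetP JH) tH].
      by have := CH tC; rewrite tH.
    have tAC : t \in A' :&: C by rewrite inE tA'.
    apply: (@le_trans _ _ (lam' t * r t)).
      rewrite ler_wpM2l ?lam'0//.
      have := ler_norm (dotp (G t z) (x - z) - (c t x - c t z)).
      rewrite distrC => D'; have := cpos t tAC.
      have : c t x <= `|violation t x|.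
        by rewrite /violation tC; apply: le_trans (ler_norm _); rewrite le_max lexx.
      have := normr_ge0 (violation t z); move: D D'; rewrite /r; lra.
    by rewrite ler_wpM2r// (le_trans (ler_norm _))// lamM.
  apply: le_trans (ler_norm _) _; rewrite normrM ler_pM// ?lamM//.
  rewrite /r /violation (negPf tC).
  have := ler_normD (dotp (G t z) (x - z) - (c t x - c t z)) (c t x - c t z).
  have := ler_normB (c t x) (c t z).
  by rewrite (distrC (dotp _ _)) subrK; move: D; lra.
have sqle : `|x - z| ^+ 2 <= M * `|x - z| * \sum_t r t.
  apply: le_trans (norm_sqr_le_dotp _) _.
  rewrite -{1}cAJ -cA'J /comb dotp_suml mulr_sumr.
  apply: (@le_trans _ _ (\sum_(t in A' :|: J) M * `|x - z| * r t)).
    by apply: ler_sum => t tA; rewrite dotpZl term.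
  rewrite [leRHS](bigID (mem (A' :|: J)))/= lerDl sumr_ge0// => t _.
  by rewrite !mulr_ge0// ltW.
have [->|xz0] := eqVneq `|x - z| 0.
  by rewrite !mulr_ge0 ?(ltW M0)// addr_ge0// sumr_ge0.
have nxz : 0 < `|x - z| by rewrite lt0r xz0 normr_ge0.
move: sqle; rewrite expr2 mulrAC ler_pM2r// /r !big_split/= sumr_const -[#|_|]/#|T|.
set a := \sum_t _; set b := \sum_t _ => le1.
have le2 : M * (e * `|x - z| *+ #|T|) <= `|x - z| / 2.
  rewrite -(mulr_natr _ #|T|) (_ : _ * _ = (#|T|%:R * M) * e * `|x - z|); last by ring.
  rewrite mulrC ler_wpM2l// /e mul1r ler_pdivrMr ?mulr_gt0//; lra.
move: le1; rewrite mulrDr; lra.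
Qed.

(** The penalty parameter is chosen so that each violation at the minimiser is
    at most [eps], and [rho] so that the minimiser stays inside the ball.
    Instead of extracting a convergent subsequence of minimisers, the continuous
    function [phi], which vanishes exactly at the feasible points within the
    desired distance, is minimised on the ball; the minimisers of the penalty
    show that its minimum is 0. *)
Lemma scalar_error_bound : exists M rho, [/\ 0 < M, 0 < rho & forall x,
  `|x - xs| < rho -> exists2 y, (forall t, violation t y = 0) &
    `|x - y| <= M * \sum_t `|violation t x|].
Proof.
have [M [d [M0 d0 key]]] := stationary_distance.
have n3 : 0 < 2 * (n%:R + 3) :> R by rewrite mulr_gt0// ltr_wpDl.
pose rho := d / (2 * (n%:R + 3)).
exists M, rho; split => // [|x xrho]; first by rewrite divr_gt0.
have rhod : (n%:R + 3) * rho = d / 2.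
  by rewrite /rho; field; rewrite gt_eqF// ltr_wpDl.
have rho0 : 0 < rho by rewrite divr_gt0.
have nrho : 0 <= n%:R * rho by rewrite mulr_ge0// ltW.
pose r z := \sum_t `|violation t z|.
have r0 z : 0 <= r z by apply: sumr_ge0.
have vxs t : violation t xs = 0.
  rewrite /violation; case: ifPn => [/xs_le0 ?|/xs_eq0//].
  by rewrite max_r.
pose B := [set z : 'rV[R]_n | `|z - xs| <= d / 2].
have B0 : B !=set0 by exists xs; rewrite /B/= subrr normr0 divr_ge0// ltW.
have cB : compact B by exact: closed_ball_compact.
have approx eps : 0 < eps -> exists2 z, B z &
    `|x - z| <= M * (r x + r z) /\ r z <= #|T|%:R * eps.
  move=> eps0.
  pose D := n%:R * `|xs - x| ^+ 2.
  have D0 : 0 <= D by rewrite mulr_ge0// sqr_ge0.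
  pose j := D / eps ^+ 2 + 1.
  have j0 : 0 < j by rewrite ltr_wpDl// divr_ge0// sqr_ge0.
  have cpen : continuous (penalty j x).
    apply: continuous_add; first exact: continuous_sqr_dist.
    apply: continuous_mul; first exact: cst_continuous.
    by apply: continuous_sum => t; apply: continuous_mul; exact: continuous_violation.
  have [z Bz zmin] := compact_min B0 cB cpen.
  have pz : penalty j x z <= D.
    apply: le_trans (zmin xs _) _; first by rewrite /B/= subrr normr0 divr_ge0// ltW.
    rewrite /penalty big1 ?mulr0 ?addr0; last by move=> t _; rewrite vxs expr0n.
    by apply: le_trans (ler_norm _) _; rewrite /D expr2 mulrA dotp_norm_le.
  have s0 : 0 <= j * \sum_t violation t z ^+ 2.
    by rewrite mulr_ge0 ?(ltW j0)// sumr_ge0// => t _; rewrite sqr_ge0.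
  have dzx : dotp (z - x) (z - x) <= D by move: pz; rewrite /penalty; lra.
  have zx : `|z - x| <= (n%:R + 1) * `|xs - x|.
    rewrite -ler_sqr ?nnegrE ?mulr_ge0//.
    apply: le_trans (norm_sqr_le_dotp _) _; apply: le_trans dzx _.
    rewrite /D exprMn ler_wpM2r ?sqr_ge0// sqrrD1.
    by have := ler0n R n; have := sqr_ge0 (n%:R : R); lra.
  have zxs : `|z - xs| < d / 2.
    have := ler_distD x z xs; rewrite (distrC xs) in zx *.
    have : (n%:R + 1) * `|x - xs| <= (n%:R + 1) * rho
      by rewrite ler_wpM2l ?ltW// ltr_wpDl.
    by move: rhod zx xrho; lra.
  have nearmin : \forall w \near z, penalty j x z <= penalty j x w.
    apply/near_ballP; exists (d / 2 - `|z - xs|); first by rewrite subr_gt0.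
    move=> w wz; apply: zmin; rewrite /B/=.
    have := ler_distD z w xs; lra.
  have st := penalty_stationary (ltW j0) nearmin.
  exists z => //; split.
    apply: key st => //; [lra|lra|move=> t tC|move=> t].
      apply: mulr_ge0; first exact: ltW.
      by rewrite /violation tC le_max lexx orbT.
    by apply: contraNneq => ->; rewrite mulr0.
  rewrite /r -sum1_card natr_sum mulr_suml; apply: ler_sum => t _; rewrite mul1r.
  have : j * violation t z ^+ 2 <= D.
    apply: (@le_trans _ _ (j * \sum_t violation t z ^+ 2)).
      rewrite ler_wpM2l ?(ltW j0)// (bigD1 t)//= lerDl sumr_ge0// => s _.
      exact: sqr_ge0.
    have : 0 <= dotp (z - x) (z - x).
      by apply: le_trans (norm_sqr_le_dotp _); rewrite sqr_ge0.
    by move: pz; rewrite /penalty; lra.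
  move=> jD; rewrite -[leRHS]gtr0_norm// -ler_sqr ?nnegrE// !real_normK ?num_real//.
  have e2 : 0 < eps ^+ 2 by rewrite exprn_gt0.
  rewrite -(ler_pM2l j0); apply: le_trans jD _.
  by rewrite /j mulrDl divfK ?gt_eqF// lerDl mul1r ltW.
pose phi z := r z + Num.max (`|x - z| - M * r x) 0.
have cr : continuous r.
  apply: continuous_sum => t z.
  exact: (continuous_comp (@continuous_violation t z) (@norm_continuous _ R^o _)).
have cphi : continuous phi.
  by apply: continuous_add => //; exact: continuous_excess_dist.
have [y By ymin] := compact_min B0 cB cphi.
have phiy : phi y <= 0.
  rewrite leNgt; apply/negP => phi0.
  have T1 : 0 < (1 + M) * (#|T|%:R + 1).
    by rewrite mulr_gt0// ?ltr_wpDl// addr_gt0.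
  have [z Bz [xz rz]] := approx _ (divr_gt0 phi0 T1).
  have : phi z <= (1 + M) * r z.
    have Mr : 0 <= M * r z by rewrite mulr_ge0// ltW.
    rewrite /phi mulrDl mul1r lerD2l ge_max Mr andbT.
    by move: xz; rewrite mulrDr; lra.
  apply/negP; rewrite -ltNge; apply: lt_le_trans (ymin z Bz).
  have M1 : 0 < 1 + M by rewrite addr_gt0.
  apply: (@le_lt_trans _ _ ((1 + M) * (#|T|%:R * (phi y / ((1 + M) * (#|T|%:R + 1)))))).
    by rewrite ler_pM2l.
  rewrite !mulrA ltr_pdivrMr// (mulrC (phi y)) ltr_pM2r// ltr_pM2l//.
  by rewrite ltrDl.
have m0 : 0 <= Num.max (`|x - y| - M * r x) 0 by rewrite le_max lexx orbT.
have ry : r y = 0 by move: phiy (r0 y) m0; rewrite /phi; lra.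
exists y.
  move=> t; apply/normr0_eq0.
  exact: (psumr_eq0P (fun t _ => normr_ge0 (violation t y)) ry).
have : `|x - y| - M * r x <= Num.max (`|x - y| - M * r x) 0 by rewrite le_max lexx.
by move: phiy; rewrite /phi ry /r; lra.
Qed.

End ErrorBound.

(** * Equivalence of norms *)
Section NormEquivalence.
Variables (R : realType) (k : nat) (nrm : 'rV[R]_k -> R).
Hypothesis nrmP : is_norm nrm.

Let nrmD x y : nrm (x + y) <= nrm x + nrm y. Proof. by have [_ ? _] := nrmP. Qed.
Let nrmZ a x : nrm (a *: x) = `|a| * nrm x. Proof. by have [_ _ ?] := nrmP. Qed.

Lemma is_norm0 : nrm 0 = 0.
Proof. by rewrite -(scale0r 0) nrmZ normr0 mul0r. Qed.

Lemma is_normN x : nrm (- x) = nrm x.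
Proof. by rewrite -scaleN1r nrmZ normrN normr1 mul1r. Qed.

Lemma is_norm_ge0 x : 0 <= nrm x.
Proof.
have := nrmD x (- x); rewrite subrr is_norm0 is_normN; lra.
Qed.

Lemma is_norm_le : exists2 a, 0 < a & forall x, nrm x <= a * `|x|.
Proof.
exists (\sum_(i < k) nrm (delta_mx 0 i) + 1).
  by rewrite ltr_wpDl// sumr_ge0// => i _; exact: is_norm_ge0.
move=> x; rewrite {1}(row_sum_delta x) mulrDl mul1r ler_wpDr// mulr_suml.
elim/big_ind2 : _ => [|x1 x2 y1 y2 le1 le2|i _].
- by rewrite is_norm0.
- exact: le_trans (nrmD _ _) (lerD le1 le2).
- by rewrite nrmZ mulrC ler_wpM2l ?is_norm_ge0// coord_le_norm.
Qed.

Lemma is_norm_ge : exists2 a, 0 < a & forall x, a * `|x| <= nrm x.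
Proof.
apply: homogeneous_lower_bound.
- have [a a0 aP] := is_norm_le.
  apply: (@lipschitz_continuous _ _ _ a) => x y; apply: le_trans (aP _).
  rewrite ler_norml; have := nrmD (x - y) y; have := nrmD (y - x) x.
  by rewrite !subrK -(is_normN (x - y)) opprB; lra.
- by move=> a v a0; rewrite nrmZ ger0_norm.
- move=> v v0; rewrite lt0r is_norm_ge0 andbT; apply: contra v0 => /eqP nv0.
  by have [/(_ v nv0) -> _ _] := nrmP.
Qed.

End NormEquivalence.

(** * Strict differentiability of continuously differentiable maps *)
Section StrictDifferentiability.
Variables (R : realType) (n q : nat) (F : 'rV[R]_n -> 'rV[R]_q).
Hypothesis C1F : continuously_differentiable F.
Implicit Types (b : 'rV[R]_q).

Lemma dotp_jacT b x v : dotp (jacT F x b) v = dotp b ('d F x v).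
Proof.
have -> : 'd F x v = v *m 'J F x by rewrite /jacobian mul_rV_lin1.
by rewrite !dotpE /jacT trmx_mul mulmxA.
Qed.

Lemma is_derive_line b (y w : 'rV[R]_n) (s : R) :
  is_derive s 1 (fun t : R => dotp b (F (y + t *: w)))
    (dotp b ('d F (y + s *: w) w)).
Proof.
have dF := C1F.1 (y + s *: w).
have /cvg_ex[l Fl] : derivable F (y + s *: w) w by exact: diff_derivable.
have lE : l = 'd F (y + s *: w) w.
  by rewrite -deriveE//; apply/esym; apply: (cvg_lim _ Fl).
have cb : continuous (fun v : 'rV[R]_q => dotp b v).
  apply: (@lipschitz_continuous _ _ _ (q%:R * `|b|)) => u v.
  by rewrite -dotpBr dotp_norm_le.
pose phi (t : R) : R^o := dotp b (F (y + t *: w)).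
have cv : (fun h : R => h^-1 *: ((phi \o shift s) (h *: 1) - phi s)) @ 0^'
    --> (dotp b l : R^o).
  have -> : (fun h : R => h^-1 *: ((phi \o shift s) (h *: 1) - phi s)) =
      (fun h : R => dotp b (h^-1 *: ((F \o shift (y + s *: w)) (h *: w)
         - F (y + s *: w)))).
    apply/funext => h /=; rewrite dotpZr dotpBr; congr (_ * (dotp b (F _) - _)).
    by rewrite [h *: 1]mulr1 scalerDl addrCA.
  exact: (continuous_cvg _ (cb l) Fl).
rewrite -lE.
by apply: DeriveDef; [apply: cvgP cv|apply: cvg_lim cv].
Qed.

Lemma line_mean_value b (x y : 'rV[R]_n) : exists2 s, 0 <= s <= 1 &
  dotp b (F x) - dotp b (F y) = dotp b ('d F (y + s *: (x - y)) (x - y)).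
Proof.
have [||s] := @MVT_segment R (fun t : R => dotp b (F (y + t *: (x - y))))
   (fun s => dotp b ('d F (y + s *: (x - y)) (x - y))) 0 1 ler01.
- by move=> s _; exact: is_derive_line.
- apply: derivable_within_continuous => s _.
  by have [] := is_derive_line b y (x - y) s.
rewrite in_itv/= => s01.
rewrite scale1r scale0r addr0 subr0 mulr1 (addrC y (x - y)) subrK => e.
by exists s.
Qed.

(** The mean value theorem on the segment [y, x] gives the differential at a point
    of the segment, which lies in the ball where the differential is close to
    that at [z]. *)
Lemma strict_differentiability b z e : 0 < e -> exists2 d, 0 < d &
  forall x y, `|x - z| < d -> `|y - z| < d ->
    `|dotp b (F x) - dotp b (F y) - dotp (jacT F z b) (x - y)| <= e * `|x - y|.
Proof.
move=> e0; have q1 : 0 < q%:R * `|b| + 1 by rewrite ltr_wpDl// mulr_ge0.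
have [d d0 dP] := (near_ballP _ _).1 (C1F.2 z _ (divr_gt0 e0 q1)).
exists d => // x y xd yd.
have [s /andP[s0 s1] ->] := line_mean_value b x y.
rewrite dotp_jacT -dotpBr; apply: le_trans (dotp_norm_le _ _) _.
apply: (@le_trans _ _ ((q%:R * `|b|) * (e / (q%:R * `|b| + 1) * `|x - y|))).
  rewrite ler_wpM2l ?mulr_ge0//; apply: dP.
  rewrite (_ : _ - z = s *: (x - z) + (1 - s) *: (y - z)); last first.
    rewrite scalerBl scale1r addrCA -scalerBr opprB addrA subrK.
    by rewrite addrAC.
  apply: le_lt_trans (ler_normD _ _) _.
  rewrite !normrZ ger0_norm// ger0_norm ?subr_ge0//.
  have [->|s00] := eqVneq s 0; first by rewrite mul0r add0r subr0 mul1r.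
  have : s * `|x - z| < s * d by rewrite ltr_pM2l// lt0r s00.
  have : (1 - s) * `|y - z| <= (1 - s) * d.
    by rewrite ler_wpM2l ?subr_ge0// ltW.
  lra.
rewrite mulrA ler_wpM2r// mulrCA ler_piMr ?(ltW e0)//.
by rewrite ler_pdivrMr// mul1r lerDl.
Qed.

Lemma jacT_continuous b z e : 0 < e ->
  \forall u \near z, `|jacT F u b - jacT F z b| <= e.
Proof.
move=> e0; have q1 : 0 < q%:R * `|b| + 1 by rewrite ltr_wpDl// mulr_ge0.
have /near_sub := C1F.2 z _ (divr_gt0 e0 q1); apply => u uP.
apply: norm_le_coord => [|i]; first exact: ltW.
rewrite -(dotp_delta i (jacT F u b - jacT F z b)) dotpC dotpBl.
have -> : dotp (jacT F u b) (delta_mx 0 i) - dotp (jacT F z b) (delta_mx 0 i) =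
    dotp b ('d F u (delta_mx 0 i) - 'd F z (delta_mx 0 i)).
  by rewrite dotpBr; congr (_ - _); exact: dotp_jacT.
apply: le_trans (dotp_norm_le _ _) _.
apply: (@le_trans _ _ ((q%:R * `|b|) * (e / (q%:R * `|b| + 1) * 1))).
  rewrite ler_wpM2l ?mulr_ge0//; apply: le_trans (uP _) _.
  rewrite ler_wpM2l ?divr_ge0 ?(ltW e0) ?(ltW q1)//.
  apply: norm_le_coord => // j; rewrite mxE; case: (_ && _) => /=.
    by rewrite normr1.
  by rewrite normr0.
rewrite mulr1 mulrCA ler_piMr ?(ltW e0)//.
by rewrite ler_pdivrMr// mul1r lerDl.
Qed.

Lemma grad_jacT (i : 'I_q) x : grad F i x = jacT F x (delta_mx 0 i).
Proof. by rewrite /grad /jacT -rowE tr_col. Qed.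

End StrictDifferentiability.

(** * Normal cones of a union of subspaces *)
Section Branches.
Variables (R : realType) (q N : nat) (Sr : 'I_N -> {vspace 'rV[R]_q}).
Implicit Types (U : {vspace 'rV[R]_q}) (s v w x y z : 'rV[R]_q).

(** The columns of the cokernel of a basis matrix of [U] are orthogonal to [U], and
    one of them detects [y]. *)
Lemma orthogonal_separation U y : y \notin U ->
  exists2 v, orthogonal_complement U v & dotp v y != 0.
Proof.
move=> yU; pose M := \matrix_(i < \dim U) (vbasis U)`_i.
have MU v : (v <= M)%MS -> v \in U.
  move=> /submxP[D ->]; rewrite mulmx_sum_row memv_suml// => i _.
  by rewrite rowK memvZ// vbasis_mem// mem_nth// size_tuple.
have UM v : v \in U -> (v <= M)%MS.
  move=> /coord_vbasis ->; rewrite summx_sub// => i _.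
  by rewrite scalemx_sub// -(rowK (fun i : 'I_(\dim U) => (vbasis U)`_i)) row_sub.
have dc j v : dotp (col j (cokermx M))^T v = (v *m cokermx M) 0 j.
  by rewrite dotpC dotpE trmxK !mxE; apply: eq_bigr => i _; rewrite mxE.
have : y *m cokermx M != 0 by rewrite -submxE; apply: contra yU => /MU.
move=> /eqP/rowP/existsNP[j]; rewrite [RHS]mxE => /eqP yj.
exists (col j (cokermx M))^T; last by rewrite dc.
by move=> s /UM; rewrite submxE dc => /eqP ->; rewrite mxE.
Qed.

Lemma near_notin U y : y \notin U -> \forall z \near y, z \notin U.
Proof.
move=> /orthogonal_separation[v vU vy].
have q1 : 0 < q%:R * `|v| + 1 by rewrite ltr_wpDl// mulr_ge0.
apply/near_ballP; exists (`|dotp v y| / (q%:R * `|v| + 1)).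
  by rewrite divr_gt0// normr_gt0.
move=> z; rewrite ltr_pdivlMr// => zy; apply/negP => zU.
have := dotp_norm_le v (z - y); rewrite dotpBr (vU z zU) sub0r normrN.
by have := normr_ge0 (z - y); move: zy; lra.
Qed.

Lemma near_active y : \forall z \near y, forall r, z \in Sr r -> y \in Sr r.
Proof.
apply: near_forall => r; have [yr|yr] := boolP (y \in Sr r).
  by apply: near_all.
by have /near_sub := near_notin yr; apply => z /negPf ->.
Qed.

(** If all subspaces through [z] are contained in one of them, the union coincides
    with that subspace near [z]. *)
Lemma frechet_normal_cone_dominant z r : z \in Sr r ->
  (forall r', z \in Sr r' -> (Sr r' <= Sr r)%VS) ->
  frechet_normal_cone (union_of_subspaces Sr) z = orthogonal_complement (Sr r).
Proof.
move=> zr dom; apply/seteqP; split=> v vN.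
  have le0 s : s \in Sr r -> dotp v s <= 0.
    move=> sr; apply/ler_addgt0Pr => e e0; rewrite add0r.
    have s1 : 0 < `|s| + 1 by rewrite ltr_wpDl.
    have := vN _ (divr_gt0 e0 s1); rewrite near_withinE => /near_ballP[d d0 dP].
    pose t := d / (2 * (`|s| + 1)).
    have t0 : 0 < t by rewrite divr_gt0// mulr_gt0.
    have zt : z + t *: s - z = t *: s by rewrite addrC addKr.
    have := dP (z + t *: s); rewrite zt normrZ gtr0_norm// dotpZr => H.
    have td : t * `|s| < d.
      rewrite /t mulrAC ltr_pdivrMr ?mulr_gt0// ltr_pM2l//.
      by have := normr_ge0 s; lra.
    have := H td (ex_intro _ r (memvD zr (memvZ t sr))).
    rewrite mulrCA ler_pM2l// => /le_trans; apply.
    by rewrite mulrAC ler_pdivrMr// ler_wpM2l ?(ltW e0)// lerDl.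
  move=> s sr; apply/eqP; rewrite eq_le le0//=.
  by rewrite -oppr_le0 -dotpNr le0// memvN.
move=> e e0; rewrite near_withinE.
have /near_sub := near_active z; apply => w wP [r' wr'].
have wr : w \in Sr r by apply: (subvP (dom _ (wP _ wr'))).
by rewrite vN ?memvB// mulr_ge0// ltW.
Qed.

(** Take [r] of maximal dimension above [r0], and [z] in [Sr r] near [y] lying in as
    few subspaces as possible.  Moving [z] slightly in any direction of [Sr r]
    loses no subspace, by minimality, and gains none, by closedness; so every
    subspace through [z] contains [Sr r], hence equals it by maximality. *)
Lemma dominant_branch (y : 'rV[R]_q) (r0 : 'I_N) e : 0 < e -> y \in Sr r0 ->
  exists r z, [/\ (Sr r0 <= Sr r)%VS, z \in Sr r, `|z - y| < e &
    forall r', z \in Sr r' -> (Sr r' <= Sr r)%VS].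
Proof.
move=> e0 yr0.
have [r r0r rmax] :=
  @arg_maxnP _ r0 (fun r => Sr r0 <= Sr r)%VS (fun r => \dim (Sr r)) (subvv _).
have yr : y \in Sr r by apply: (subvP r0r).
pose act z := #|[set r' | z \in Sr r']%SET|.
pose Q k := `[< exists z, [/\ z \in Sr r, `|z - y| < e & act z = k] >].
have exQ : exists k, Q k.
  by exists (act y); apply/asboolP; exists y; rewrite subrr normr0.
case: (ex_minnP exQ) => k /asboolP[z [zr zy zk]] kmin.
exists r, z; split => // r' zr'.
suff rr' : (Sr r <= Sr r')%VS.
  have /eqP <- // : Sr r == Sr r'.
  by rewrite eqEdim rr'; apply: rmax; exact: subv_trans r0r rr'.
apply/subvP => w wr.
have [d d0 dP] := (near_ballP _ _).1 (near_active z).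
have zy' : 0 < e - `|z - y| by rewrite subr_gt0.
pose t := Num.min d (e - `|z - y|) / (2 * (`|w| + 1)).
have w1 : 0 < 2 * (`|w| + 1) by rewrite mulr_gt0// ltr_wpDl.
have t0 : 0 < t by rewrite divr_gt0// lt_min d0.
have tw : `|z + t *: w - z| < Num.min d (e - `|z - y|).
  rewrite (addrC z) addrK normrZ gtr0_norm// /t mulrAC ltr_pdivrMr//.
  rewrite ltr_pM2l ?lt_min ?d0//.
  by have := normr_ge0 w; lra.
move: tw; rewrite lt_min => /andP[twd twe].
have zwr : z + t *: w \in Sr r by rewrite memvD// memvZ.
have kle : (act z <= act (z + t *: w)%R)%N.
  rewrite zk; apply: kmin; apply/asboolP; exists (z + t *: w); split => //.
  by have := ler_distD z (z + t *: w) y; lra.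
have sub : [set r' | (z + t *: w)%R \in Sr r']%SET \subset [set r' | z \in Sr r']%SET.
  by apply/fintype.subsetP => r1; rewrite !inE; exact: dP.
have /eqP eqI : [set r' | (z + t *: w)%R \in Sr r']%SET == [set r' | z \in Sr r']%SET.
  by rewrite eqEcard sub.
have : r' \in [set r' | (z + t *: w)%R \in Sr r']%SET by rewrite eqI inE.
rewrite inE => zwr'.
have : t *: w \in Sr r' by rewrite -(addKr z (t *: w)) addrC memvB.
by move=> /(memvZ t^-1); rewrite scalerA mulVf ?gt_eqF// scale1r.
Qed.

(** The generators chosen at the point [z] of [dominant_branch] span the orthogonal
    complement of a maximal subspace that contains [Sr r0]. *)
Lemma branch_generators (nY : 'rV[R]_q -> R) Ahat delta (y : 'rV[R]_q) r0 :
  is_norm nY -> generator_choice nY (union_of_subspaces Sr) Ahat delta ->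
  y \in Sr r0 ->
  exists B : seq 'rV[R]_q, [/\ free B,
    [set a | a \in B] `<=` generator_set nY (union_of_subspaces Sr) Ahat delta y,
    forall v s, v \in <<B>>%VS -> s \in Sr r0 -> dotp v s = 0,
    [set v | v \in <<B>>%VS] `<=` active_orthogonals Sr y &
    forall x, (forall b, b \in B -> dotp b x = 0) -> union_of_subspaces Sr x].
Proof.
move=> nYP gen yr0.
have Sy : union_of_subspaces Sr y by exists r0.
have [_ _ delta0 _] := gen y Sy.
have [a a0 aP] := is_norm_le nYP.
have [r [z [r0r zr zy dom]]] := dominant_branch (divr_gt0 delta0 a0) yr0.
have Sz : union_of_subspaces Sr z by exists r.
have [fA NA _ _] := gen z Sz.
rewrite (frechet_normal_cone_dominant zr dom) in NA.
have AP v : v \in <<Ahat z>>%VS -> orthogonal_complement (Sr r) v by rewrite NA.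
exists (Ahat z); split => //.
- move=> b /= bA; exists z => //; split => //.
  by apply: le_lt_trans (aP _) _; rewrite mulrC -ltr_pdivlMr.
- by move=> v s /AP vr sr0; apply: vr; apply: (subvP r0r).
- by move=> v /AP vr; exists r => //; apply: (subvP r0r).
move=> x Ax; exists r; apply/negPn/negP => /orthogonal_separation[v].
rewrite NA /= => vA; apply/negP; rewrite negbK; apply/eqP.
rewrite (coord_span (X := in_tuple (Ahat z)) vA) dotp_suml big1// => i _.
by rewrite dotpZl Ax ?mulr0// mem_nth.
Qed.

End Branches.

(** * Families indexed by finite types *)
Lemma free_map (R : realType) (V : vectType R) (T : finType) (f : T -> V) (s : seq T) :
  uniq s ->
  (forall lam : T -> R, \sum_(t in s) lam t *: f t = 0 ->
     {in s, forall t, lam t = 0}) ->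
  free [seq f t | t <- s].
Proof.
move=> us ind; apply/(@freeP _ _ _ (map_tuple f (in_tuple s))) => k k0 i.
case: s => [|t0 s'] in us ind k k0 i *; first by case: i.
set s := t0 :: s' in us ind k k0 i *.
pose lam t := if (insub (index t s) : option 'I_(size s)) is Some j then k j else 0.
have lamE (j : 'I_(size s)) : lam (nth t0 s j) = k j.
  by rewrite /lam index_uniq ?ltn_ord// valK.
rewrite -lamE; apply: ind; last by rewrite mem_nth.
rewrite -[RHS]k0 -big_uniq//= (big_nth t0) big_mkord; apply: eq_bigr => j _.
by rewrite lamE; congr (_ *: _); rewrite -[RHS]/(nth 0 [seq f t | t <- s] j) (nth_map t0).
Qed.

Section IndexedFamilies.
Variables (R : realType) (V : vectType R) (T : finType).
Implicit Types (f : T -> V) (s : seq T) (A : {set T}).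

Lemma span_mapP f s v : uniq s -> v \in <<[seq f t | t <- s]>>%VS ->
  exists lam : T -> R, v = \sum_(t in s) lam t *: f t.
Proof.
elim: s v => [|t s IHs] v /=.
  by move=> _; rewrite span_nil memv0 => /eqP ->; exists (fun=> 0); rewrite big_pred0.
move=> /andP[ts us]; rewrite span_cons => /memv_addP[v1 /vlineP[a ->] [v2 /IHs]].
move=> /(_ us)[lam ->] ->; exists (fun t' => if t' == t then a else lam t').
rewrite -!big_uniq/= ?ts// big_cons eqxx; congr (_ + _).
by apply: eq_big_seq => t' t's; case: eqVneq => // e; rewrite -e t's in ts.
Qed.

Lemma free_mapP f s (lam : T -> R) : uniq s -> free [seq f t | t <- s] ->
  \sum_(t in s) lam t *: f t = 0 -> {in s, forall t, lam t = 0}.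
Proof.
elim: s => [|t s IHs] //= /andP[ts us]; rewrite free_cons => /andP[tn fs].
rewrite -big_uniq/= ?ts// big_cons big_uniq// => e.
have lt0 : lam t = 0.
  apply/eqP; apply: contraNT tn => lt.
  have -> : f t = - (lam t)^-1 *: \sum_(i in s) lam i *: f i.
    move/eqP: e; rewrite addr_eq0 => /eqP e.
    by rewrite scaleNr -scalerN -e scalerA mulVf// scale1r.
  rewrite memvZ// memv_suml// => i si; rewrite memvZ// memv_span//.
  exact: map_f.
move: e; rewrite lt0 scale0r add0r => /(IHs us fs) l0 t'.
by rewrite inE => /orP[/eqP ->//|/l0].
Qed.

(** A subset of maximal cardinality among those with independent images. *)
Lemma basis_of_subfamily f : exists A,
  basis_of <<[seq f t | t : T]>>%VS [seq f t | t <- enum A].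
Proof.
have free0 : free [seq f t | t <- enum (finset.set0 : {set T})].
  by rewrite enum_set0 nil_free.
have [A fA Amax] := @arg_maxnP _ finset.set0
  (fun A : {set T} => free [seq f t | t <- enum A]) (fun A => #|A|) free0.
exists A; rewrite /basis_of fA andbT eqEsubv; apply/andP; split.
  apply/span_subvP => v /mapP[t _ ->]; apply: memv_span.
  by apply: map_f; rewrite mem_enum.
apply/span_subvP => v /mapP[t _ ->].
have [tA|tA] := boolP (t \in A).
  by apply: memv_span; apply: map_f; rewrite mem_enum.
apply/negPn/negP => ft.
have ptA : perm_eq (t :: enum A) (enum (t |: A)).
  apply: uniq_perm; rewrite /= ?mem_enum ?tA ?enum_uniq// => t'.
  by rewrite inE !mem_enum !inE.
have := Amax (t |: A); rewrite -(perm_free (perm_map f ptA)) /= free_cons ft fA.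
by rewrite cardsU1 tA /geq/= ltnn => /(_ isT).
Qed.

End IndexedFamilies.

Lemma punctured_near_seq (R : realType) (n : nat) (xs : 'rV[R]_n)
    (P : 'rV[R]_n -> Prop) :
  (forall x : nat -> 'rV[R]_n, x @ \oo --> xs -> (forall k, x k != xs) ->
     \forall k \near \oo, P (x k)) ->
  \forall u \near xs, u != xs -> P u.
Proof.
move=> seqP; apply: contrapT => nP.
have bad k : exists u, [/\ `|u - xs| < k.+1%:R^-1, u != xs & ~ P u].
  apply: contrapT => nu; apply: nP; apply/near_ballP.
  exists k.+1%:R^-1; first by rewrite invr_gt0.
  move=> u uk uxs; apply: contrapT => nPu; apply: nu.
  by exists u.
have [x xP] := choice bad.
have [||k _ kP] := seqP x.
- apply/(@cvgrPdist_lt _ _ _ (x @ \oo)) => e e0.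
  have := near_infty_natSinv_lt (PosNum e0); apply: filterS => k /= ke.
  by rewrite distrC; have [xk _ _] := xP k; exact: lt_trans xk ke.
- by move=> k; have [] := xP k.
by have [_ _] := xP k; apply; apply: kP => /=.
Qed.

(** * One selection of subspaces *)

(** [B i] generates the orthogonal complement of the subspace selected for
    [Phi i], so that the selected piece of the feasible set is cut out by the
    scalar constraints below. *)
Section OneBranch.
Variables (R : realType) (n m p l q N : nat).
Variables (nX : 'rV[R]_n -> R) (nY : 'rV[R]_q -> R).
Variables (g : 'rV[R]_n -> 'rV[R]_m) (h : 'rV[R]_n -> 'rV[R]_p).
Variables (Phi : 'I_l -> 'rV[R]_n -> 'rV[R]_q).
Variables (Sr : 'I_N -> {vspace 'rV[R]_q}).
Variables (Ahat : 'rV[R]_q -> seq 'rV[R]_q) (delta : 'rV[R]_q -> R).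
Variables (xs : 'rV[R]_n) (B : 'I_l -> seq 'rV[R]_q).
Hypotheses (normX : is_norm nX) (normY : is_norm nY).
Hypothesis C1g : continuously_differentiable g.
Hypothesis C1h : continuously_differentiable h.
Hypothesis C1Phi : forall i, continuously_differentiable (Phi i).
Hypothesis xsF : feasible_set g h Phi (union_of_subspaces Sr) xs.
Hypothesis rcpld : MPDSC_RCPLD nX nY g h Phi Sr Ahat delta xs.
Hypothesis freeB : forall i, free (B i).
Hypothesis genB : forall i, [set a | a \in B i] `<=`
  generator_set nY (union_of_subspaces Sr) Ahat delta (Phi i xs).
Hypothesis actB : forall i,
  [set v | v \in <<B i>>%VS] `<=` active_orthogonals Sr (Phi i xs).
Hypothesis xsB : forall i b, b \in B i -> dotp b (Phi i xs) = 0.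

Definition constraint_index := ('I_m + 'I_p + {i : 'I_l & 'I_(size (B i))})%type.
Definition iG (i : 'I_m) : constraint_index := inl (inl i).
Definition iH (i : 'I_p) : constraint_index := inl (inr i).
Definition iP (i : 'I_l) (j : 'I_(size (B i))) : constraint_index :=
  inr (Tagged (fun i => 'I_(size (B i))) j).

Definition scalar_constraint (t : constraint_index) (x : 'rV[R]_n) : R :=
  match t with
  | inl (inl i) => g x 0 i
  | inl (inr i) => h x 0 i
  | inr u => dotp (B (tag u))`_(tagged u) (Phi (tag u) x)
  end.

Definition gradient (t : constraint_index) (x : 'rV[R]_n) : 'rV[R]_n :=
  match t with
  | inl (inl i) => grad g i x
  | inl (inr i) => grad h i x
  | inr u => jacT (Phi (tag u)) x (B (tag u))`_(tagged u)
  end.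

Lemma scalar_strict_diff t z e : 0 < e -> exists2 d, 0 < d &
  forall x y, `|x - z| < d -> `|y - z| < d ->
    `|scalar_constraint t x - scalar_constraint t y - dotp (gradient t z) (x - y)|
      <= e * `|x - y|.
Proof.
case: t => [[i|i]|u] e0 /=; last exact: strict_differentiability.
  have [d d0 dP] := strict_differentiability C1g (delta_mx 0 i) z e0.
  exists d => // x y xd yd; rewrite grad_jacT -!(dotp_delta i).
  exact: dP.
have [d d0 dP] := strict_differentiability C1h (delta_mx 0 i) z e0.
exists d => // x y xd yd; rewrite grad_jacT -!(dotp_delta i).
exact: dP.
Qed.

Lemma gradient_continuous t e : 0 < e ->
  \forall u \near xs, `|gradient t u - gradient t xs| <= e.
Proof.
case: t => [[i|i]|u] e0 /=; last exact: jacT_continuous.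
  have /near_sub := jacT_continuous C1g (delta_mx 0 i) xs e0; apply => u.
  by rewrite -!grad_jacT.
have /near_sub := jacT_continuous C1h (delta_mx 0 i) xs e0; apply => u.
by rewrite -!grad_jacT.
Qed.

Lemma big_constraint_index (V : nmodType) (F : constraint_index -> V) :
  \sum_t F t = \sum_i F (iG i) + \sum_i F (iH i) + \sum_i \sum_j F (@iP i j).
Proof.
rewrite !big_sumType/=; congr (_ + _).
by rewrite sig_big_dep/=; apply: eq_bigr => -[i j].
Qed.

Lemma big_constraint_index_cond (V : nmodType) (K : {set constraint_index})
    (F : constraint_index -> V) :
  \sum_(t in K) F t = \sum_(i | iG i \in K) F (iG i)
    + \sum_(i | iH i \in K) F (iH i)
    + \sum_i \sum_(j | @iP i j \in K) F (iP j).
Proof.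
rewrite big_mkcond big_constraint_index -!big_mkcond; congr (_ + _).
by apply: eq_bigr => i _; rewrite -big_mkcond.
Qed.

Definition inequalities : {set constraint_index} :=
  [set t | if t is inl (inl _) then true else false].
Definition equations : {set constraint_index} :=
  [set t | if t is inl (inr _) then true else false].
Definition basis_equations (J : {set 'I_p}) : {set constraint_index} :=
  [set iH i | i in J].

Lemma iH_basis J i : (iH i \in basis_equations J) = (i \in J).
Proof. by rewrite mem_imset// => a b []. Qed.

Lemma iG_basis J i : (iG i \in basis_equations J) = false.
Proof. by apply/negP => /imsetP[]. Qed.

Lemma iP_basis J i (j : 'I_(size (B i))) : (iP j \in basis_equations J) = false.
Proof. by apply/negP => /imsetP[]. Qed.

Lemma comb_basis J lam x :
  comb gradient (basis_equations J) lam x = \sum_(i in J) lam (iH i) *: grad h i x.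
Proof. by rewrite /comb big_imset//= => a b _ _ []. Qed.


Lemma indep_basis_equations (J : {set 'I_p}) :
  basis_of <<[seq grad h i xs | i : 'I_p]>>%VS [seq grad h i xs | i <- enum J] ->
  indep gradient (basis_equations J) xs.
Proof.
move=> bJ lam; rewrite comb_basis => l0 t /imsetP[i iJ ->].
have := free_mapP (lam := fun i => lam (iH i)) (enum_uniq _) (basis_free bJ).
rewrite (eq_bigl (mem J)); last by move=> i'; rewrite mem_enum.
by move=> /(_ l0 i); rewrite mem_enum; apply.
Qed.

(** The basis stays independent near [xs], and the rank does not grow. *)
Lemma span_equations (J : {set 'I_p}) :
  basis_of <<[seq grad h i xs | i : 'I_p]>>%VS [seq grad h i xs | i <- enum J] ->
  \forall u \near xs, forall t, t \in equations ->
    exists mu, gradient t u = comb gradient (basis_equations J) mu u.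
Proof.
move=> bJ; have [[e e0 rk] _] := rcpld.
have [a a0 aP] := is_norm_le normX.
have ball_e : \forall u \near xs, norm_ball nX xs e u.
  apply/near_ballP; exists (e / a); first by rewrite divr_gt0.
  move=> u; rewrite ltr_pdivlMr// mulrC => ue.
  by apply: le_lt_trans (aP _) ue.
have iJ := indepJ_near gradient_continuous (indep_basis_equations bJ).
have /near_sub := near_and ball_e iJ; apply => u [ue iJu] t.
case: t => [[i|i]|b]; rewrite inE // => _.
have fJ : free [seq grad h i u | i <- enum J].
  apply: free_map; first exact: enum_uniq.
  move=> lam; rewrite (eq_bigl (mem J)); last by move=> i'; rewrite mem_enum.
  move=> l0 i'; rewrite mem_enum => i'J.
  pose lam' (t : constraint_index) := if t is inl (inr i) then lam i else 0.
  by apply: (iJu lam' _ (iH i')); rewrite ?comb_basis// iH_basis.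
have sJ : (<<[seq grad h i u | i <- enum J]>> <= <<[seq grad h i u | i : 'I_p]>>)%VS.
  apply: sub_span => v /mapP[i' _ ->]; apply: map_f.
  by rewrite mem_enum.
have eJ : <<[seq grad h i u | i <- enum J]>>%VS = <<[seq grad h i u | i : 'I_p]>>%VS.
  have d1 : \dim <<[seq grad h i u | i <- enum J]>> = #|J|.
    by move/eqP: fJ => ->; rewrite size_map -cardE.
  have d2 : \dim <<[seq grad h i xs | i : 'I_p]>> = #|J|.
    rewrite -(span_basis bJ); move/eqP: (basis_free bJ) => ->.
    by rewrite size_map -cardE.
  have le := eq_leq (etrans (rk u ue) (etrans d2 (esym d1))).
  by apply/eqP; rewrite eqEdim; apply/andP; split; [exact: sJ|exact: le].
have : grad h i u \in <<[seq grad h i u | i <- enum J]>>%VS.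
  by rewrite eJ; apply: memv_span; apply: map_f; rewrite mem_enum.
move=> /(span_mapP (enum_uniq _))[lam e1].
exists (fun t : constraint_index => if t is inl (inr i) then lam i else 0).
rewrite comb_basis /= e1; apply: eq_bigl => i'; by rewrite mem_enum.
Qed.

Lemma free_constraint_family (K : {set constraint_index})
    (I : {set 'I_m}) (J : {set 'I_p})
    (D : forall i, {set 'I_(size (B i))}) u :
  indep gradient (K :|: basis_equations J) u ->
  (forall i, i \in I -> iG i \in K) ->
  (forall i j, j \in D i -> @iP i j \in K) ->
  free (constraint_family g h Phi I J
         (fun i => [seq (B i)`_j | j : 'I_(size (B i)) <- enum (D i)]) u).
Proof.
move=> ind IK DK.
pose s := [seq iG i | i <- enum I] ++ [seq iH i | i <- enum J] ++
  [seq @iP i j | i <- enum 'I_l, j <- enum (D i)].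
have sK t : t \in s -> t \in K :|: basis_equations J.
  rewrite !mem_cat inE => /or3P[/mapP[i]|/mapP[i]|/allpairsPdep[i [j [_]]]].
  - by rewrite mem_enum => /IK iK ->; rewrite iK.
  - by rewrite mem_enum => iJ ->; rewrite iH_basis iJ orbT.
  - by rewrite mem_enum => /DK jK ->; rewrite jK.
have us : uniq s.
  rewrite !cat_uniq !map_inj_uniq ?enum_uniq /=; try by move=> a b [].
  rewrite allpairs_uniq_dep ?enum_uniq//; last 2 first.
  - by move=> i _; exact: enum_uniq.
  - by move=> [i j] [i' j'] _ _ [].
  rewrite andbT; apply/andP; split.
    apply/hasPn => t; rewrite mem_cat => /orP[/mapP[i _ ->]|/allpairsPdep[i [j [_ _ ->]]]].
      by apply/mapP => -[].
    by apply/mapP => -[].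
  by apply/hasPn => t /allpairsPdep[i [j [_ _ ->]]]; apply/mapP => -[].
rewrite (_ : constraint_family _ _ _ _ _ _ _ = [seq gradient t u | t <- s]); last first.
  rewrite /s !map_cat /constraint_family -!map_comp; congr (_ ++ (_ ++ _)).
  rewrite map_flatten -map_comp; congr flatten; apply: eq_map => i /=.
  by rewrite -!map_comp.
apply: free_map => // lam l0 t ts.
pose lam' t := if t \in s then lam t else 0.
have := ind lam' _ t (sK t ts); rewrite /lam' ts; apply.
rewrite /comb -[RHS]l0 (bigID (mem s))/= [X in _ + X]big1 ?addr0; last first.
  by move=> t' /andP[_ /negPf ->]; rewrite scale0r.
apply: eq_big => [t'|t' /andP[_ ->]//].
by case: (boolP (t' \in s)) => [/sK ->|]; rewrite ?andbF.
Qed.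

(** A weight on the constraints <b, Phi_i> sums up to the vector multiplier
    [lPhi i].  The hypothesis is applied with [A i] the generators of nonzero
    weight: then [A i] is empty exactly when [lPhi i] vanishes, because [B i] is
    free.  Dependence of this smaller family implies that of the whole one. *)
Lemma rcpld_index (J : {set 'I_p}) :
  basis_of <<[seq grad h i xs | i : 'I_p]>>%VS [seq grad h i xs | i <- enum J] ->
  forall K : {set constraint_index}, K \subset ~: equations ->
  {in K :&: inequalities, forall t, scalar_constraint t xs = 0} ->
  forall lam, nonneg_on (K :&: inequalities) lam ->
  comb gradient (K :|: basis_equations J) lam xs = 0 ->
  (exists2 t, t \in K :|: basis_equations J & lam t != 0) ->
  \forall u \near xs, u != xs -> ~ indep gradient (K :|: basis_equations J) u.
Proof.
move=> bJ K Khs Kact lam lam0 cl0 lamN.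
have KG i : (iG i \in K :|: basis_equations J) = (iG i \in K).
  by rewrite inE iG_basis orbF.
have KH i : (iH i \in K :|: basis_equations J) = (i \in J).
  rewrite inE iH_basis; case: (boolP (iH i \in K)) => // /(fintype.subsetP Khs).
  by rewrite !inE.
have KP i j : (@iP i j \in K :|: basis_equations J) = (iP j \in K).
  by rewrite inE iP_basis orbF.
pose I := [set i | iG i \in K]%SET.
pose D i := [set j | (@iP i j \in K) && (lam (iP j) != 0)]%SET.
pose A i := [seq (B i)`_j | j : 'I_(size (B i)) <- enum (D i)].
pose lPhi i := \sum_(j | @iP i j \in K) lam (iP j) *: (B i)`_j.
have lPhi0 i : lPhi i = 0 -> forall j, iP j \in K -> lam (@iP i j) = 0.
  move=> li j jK; have /(@freeP _ _ _ (in_tuple (B i))) := freeB i.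
  move=> /(_ (fun j => if iP j \in K then lam (@iP i j) else 0)).
  rewrite (_ : \sum_j _ = lPhi i); last first.
    rewrite /lPhi [RHS]big_mkcond; apply: eq_bigr => j' _.
    by case: ifP => // _; rewrite scale0r.
  by move=> /(_ li j); rewrite jK.
have AB i : {subset A i <= B i}.
  by move=> b /mapP[j _ ->]; rewrite mem_nth.
have lA i : lPhi i \in <<A i>>%VS.
  rewrite memv_suml// => j jK; have [->|lj] := eqVneq (lam (iP j)) 0.
    by rewrite scale0r mem0v.
  rewrite memvZ// memv_span//; apply/mapP; exists j => //.
  by rewrite mem_enum inE jK.
have lB i : active_orthogonals Sr (Phi i xs) (lPhi i).
  by apply: actB => /=; apply: (subvP (sub_span (@AB i))).
have fA i : free (A i).
  have /(@freeP _ _ _ (in_tuple (B i))) fB := freeB i.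
  apply: (@free_map _ _ _ (fun j : 'I_(size (B i)) => (B i)`_j)).
    exact: enum_uniq.
  move=> mu mu0 j; rewrite mem_enum => jD.
  have := fB (fun j => if j \in D i then mu j else 0).
  rewrite (_ : \sum_j _ = 0); last first.
    rewrite -[RHS]mu0 [RHS]big_mkcond; apply: eq_bigr => j' _.
    by rewrite mem_enum; case: ifP => // _; rewrite scale0r.
  by move=> /(_ erefl j); rewrite jD.
have [_ /(_ J bJ I (fun i => lam (iG i)) (fun i => lam (iH i)) lPhi) RC] := rcpld.
apply: punctured_near_seq => x xxs xk.
have Ig i : i \in I -> g xs 0 i = 0.
  by rewrite inE => iK; apply: (Kact (iG i)); rewrite !inE iK.
have lg0 i : i \in I -> 0 <= lam (iG i).
  by rewrite inE => iK; apply: lam0; rewrite !inE iK.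
have nonzero : [\/ exists2 i, i \in I & lam (iG i) != 0,
    exists2 i, i \in J & lam (iH i) != 0 | exists i, lPhi i != 0].
  have [[[i|i]|[i j]] tK lt] := lamN.
  - by constructor 1; exists i => //; rewrite inE -KG.
  - by constructor 2; exists i => //; rewrite -KH.
  - constructor 3; exists i; apply: contra lt => /eqP /lPhi0 /(_ j) ->//.
    by rewrite -KP.
have sum0 : 0 = \sum_(i in I) lam (iG i) *: grad g i xs
    + \sum_(i in J) lam (iH i) *: grad h i xs
    + \sum_(i < l) jacT (Phi i) xs (lPhi i).
  rewrite -[LHS]cl0 /comb big_constraint_index_cond.
  congr (_ + _ + _).
  - by apply: eq_bigl => i; rewrite KG inE.
  - by apply: eq_bigl => i; rewrite KH.
  apply: eq_bigr => i _.
  rewrite /lPhi /jacT mulmx_suml; apply: eq_big => [j|j _]; first exact: KP.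
  by rewrite -scalemxAl.
have {}RC := RC Ig nonzero lg0 lB sum0 x A xxs xk fA.
have /RC {}RC : forall i, lPhi i != 0 ->
    [/\ [set a | a \in A i] `<=`
          generator_set nY (union_of_subspaces Sr) Ahat delta (Phi i xs),
        lPhi i \in <<A i>>%VS
      & [set v | v \in <<A i>>%VS] `<=` active_orthogonals Sr (Phi i xs)].
  move=> i _; split => // [b /= bA|v /= vA].
    by apply: genB => /=; exact: AB.
  by apply: actB => /=; apply: (subvP (sub_span (@AB i))).
have /RC : forall i, lPhi i = 0 -> A i = [::].
  move=> i /lPhi0 l0; rewrite /A (_ : D i = finset.set0) ?enum_set0//.
  by apply/finset.setP => j; rewrite !inE; apply/negP => /andP[/l0 ->]; rewrite eqxx.
apply: filterS => k; apply: contraNnot => ind.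
apply: (free_constraint_family ind) => [i|i j]; rewrite inE//.
by move=> /andP[].
Qed.

Lemma branch_error_bound : exists M rho, [/\ 0 < M, 0 < rho & forall x,
  `|x - xs| < rho -> exists y, [/\ forall i, g y 0 i <= 0, h y = 0,
      forall i b, b \in B i -> dotp b (Phi i y) = 0 &
    `|x - y| <= M * (\sum_i Num.max (g x 0 i) 0 + \sum_i `|h x 0 i|
      + \sum_i \sum_(b <- B i) `|dotp b (Phi i x)|)]].
Proof.
have [J bJ] := basis_of_subfamily (fun i => grad h i xs).
have [xg xh _] := xsF.
have le0 t : t \in inequalities -> scalar_constraint t xs <= 0.
  by case: t => [[i|i]|u]; rewrite inE//= xg.
have eq0 t : t \notin inequalities -> scalar_constraint t xs = 0.
  case: t => [[i|i]|u]; rewrite inE//= => _; first by rewrite xh mxE.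
  by apply: xsB; rewrite mem_nth.
have Jhs : basis_equations J \subset equations.
  by apply/fintype.subsetP => t /imsetP[i _ ->]; rewrite inE.
have disj : {in inequalities, forall t, t \notin equations}.
  by move=> [[i|i]|u]; rewrite !inE.
have [M [rho [M0 rho0 MP]]] := scalar_error_bound scalar_strict_diff gradient_continuous
  le0 eq0 Jhs disj (indep_basis_equations bJ) (span_equations bJ) (rcpld_index bJ).
exists M, rho; split => // x /MP[y yv xy]; exists y; split.
- move=> i; have := yv (iG i); rewrite /violation inE/= => <-.
  by rewrite le_max lexx.
- by apply/rowP => i; have := yv (iH i); rewrite /violation inE/= mxE.
- move=> i b /(nthP 0)[j jB <-].
  by have := yv (iP (Ordinal jB)); rewrite /violation inE.
apply: le_trans xy _; rewrite ler_wpM2l ?(ltW M0)// big_constraint_index.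
rewrite /violation le_eqVlt; apply/orP; left; apply/eqP; congr (_ + _ + _).
- by apply: eq_bigr => i _; rewrite inE/= ger0_norm// le_max lexx orbT.
- by apply: eq_bigr => i _; rewrite inE.
- apply: eq_bigr => i _; rewrite (big_nth 0) big_mkord; apply: eq_bigr => j _.
  by rewrite inE.
Qed.

End OneBranch.

(** * Distances and the union of all selections *)
Section Distance.
Variables (R : realType) (k : nat) (nrm : 'rV[R]_k -> R).
Hypothesis nrmP : is_norm nrm.
Implicit Types (x y : 'rV[R]_k) (Om : set 'rV[R]_k).

Lemma norm_dist_le Om x y : Om y -> norm_dist nrm Om x <= nrm (x - y).
Proof.
move=> Oy; apply: ge_inf; last by exists y.
by exists 0 => _ [z _ <-]; exact: is_norm_ge0.
Qed.

Lemma norm_dist_approx Om x e : Om !=set0 -> 0 < e ->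
  exists2 y, Om y & nrm (x - y) < norm_dist nrm Om x + e.
Proof.
move=> [y0 Oy0] e0.
have hi : has_inf [set nrm (x - y) | y in Om].
  split; first by exists (nrm (x - y0)), y0.
  by exists 0 => _ [z _ <-]; exact: is_norm_ge0.
by have [_ [y Oy <-] ylt] := inf_adherent e0 hi; exists y.
Qed.

(** A near-minimiser of the distance from [y] is itself close to [y0] when [y] is,
    so the subspaces that contain it also contain [y0]. *)
Lemma active_branch_approx (N : nat) (Sr : 'I_N -> {vspace 'rV[R]_k}) y0 :
  union_of_subspaces Sr y0 ->
  \forall y \near y0, forall e, 0 < e -> exists r s,
    [/\ y0 \in Sr r, s \in Sr r &
        nrm (y - s) <= norm_dist nrm (union_of_subspaces Sr) y + e].
Proof.
move=> Sy0; have [eta eta0 etaP] := (near_ballP _ _).1 (near_active Sr y0).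
have [a a0 aP] := is_norm_le nrmP; have [b b0 bP] := is_norm_ge nrmP.
pose c := 2 * (a + b).
have c0 : 0 < c by rewrite mulr_gt0// addr_gt0.
apply/near_ballP; exists (b * eta / c); first by rewrite divr_gt0// mulr_gt0.
move=> y; rewrite ltr_pdivlMr// => yy0 e e0.
have eb0 : 0 < Num.min e (b * eta / 2).
  by rewrite lt_min e0 divr_gt0// mulr_gt0.
have Sne : union_of_subspaces Sr !=set0 by exists y0.
have [s [r sr] slt] := norm_dist_approx y Sne eb0.
have m1 : Num.min e (b * eta / 2) <= e by rewrite ge_min lexx.
have m2 : Num.min e (b * eta / 2) <= b * eta / 2 by rewrite ge_min lexx orbT.
exists r, s; split => //; last by move: slt; lra.
apply: etaP sr.
have d1 := norm_dist_le y Sy0; have d2 := aP (y - y0); have d3 := bP (y - s).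
have d4 := ler_distD y s y0; rewrite (distrC s y) in d4.
rewrite -(ltr_pM2l b0).
have : b * `|s - y0| <= b * `|y - s| + b * `|y - y0|.
  by rewrite -mulrDr ler_pM2l.
by move: yy0; rewrite /c; lra.
Qed.

End Distance.

Theorem theorem3p3 (R : realType) (n m p l q N : nat)
    (nX : 'rV[R]_n -> R) (nY : 'rV[R]_q -> R)
    (f : 'rV[R]_n -> R)
    (g : 'rV[R]_n -> 'rV[R]_m) (h : 'rV[R]_n -> 'rV[R]_p)
    (Phi : 'I_l -> 'rV[R]_n -> 'rV[R]_q)
    (Sr : 'I_N -> {vspace 'rV[R]_q})
    (Ahat : 'rV[R]_q -> seq 'rV[R]_q) (delta : 'rV[R]_q -> R)
    (xs : 'rV[R]_n)
    (normX : is_norm nX) (normY : is_norm nY)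
    (C1f : continuously_differentiable f)
    (C1g : continuously_differentiable g)
    (C1h : continuously_differentiable h)
    (C1Phi : forall i, continuously_differentiable (Phi i))
    (genA : generator_choice nY (union_of_subspaces Sr) Ahat delta)
    (xsF : feasible_set g h Phi (union_of_subspaces Sr) xs)
    (rcpld : MPDSC_RCPLD nX nY g h Phi Sr Ahat delta xs) :
  exists alpha rho : R, [/\ 0 <= alpha, 0 < rho &
    forall x, norm_ball nX xs rho x ->
      norm_dist nX (feasible_set g h Phi (union_of_subspaces Sr)) x <=
      alpha * (\sum_(i < m) Num.max (g x 0 i) 0
             + \sum_(i < p) `|h x 0 i|
             + \sum_(i < l) norm_dist nY (union_of_subspaces Sr) (Phi i x))].
Proof.
pose S := union_of_subspaces Sr.
have [_ _ xsS] := xsF.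
have [a a0 aP] := is_norm_le normX; have [a' a'0 a'P] := is_norm_ge normX.
have [b b0 bP] := is_norm_ge normY.
pose act (r : {ffun 'I_l -> 'I_N}) := forall i, Phi i xs \in Sr (r i).
pose res (x : 'rV[R]_n) :=
  \sum_(i < m) Num.max (g x 0 i) 0 + \sum_(i < p) `|h x 0 i|.
(* For an active selection r and any choice of points s in the selected
   subspaces, <b, Phi_i x> = <b, Phi_i x - s_i> turns the scalar residuals into
   distances. *)
have branch (r : {ffun 'I_l -> 'I_N}) : exists M, 0 < M /\ \forall x \near xs,
    act r -> forall s : 'I_l -> 'rV[R]_q, (forall i, s i \in Sr (r i)) ->
    exists2 y, feasible_set g h Phi S y &
      `|x - y| <= M * (res x + \sum_i nY (Phi i x - s i)).
  have [ar|nar] := pselect (act r); last first.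
    by exists 1; split => //; apply: near_all => x /nar.
  have [B BP] := choice (fun i => branch_generators normY genA (ar i)).
  have [||||M [rho [M0 rho0 MP]]] :=
    branch_error_bound normX C1g C1h C1Phi xsF rcpld (B := B).
  - by move=> i; have [] := BP i.
  - by move=> i; have [] := BP i.
  - by move=> i; have [] := BP i.
  - move=> i c cB; have [_ _ orth _ _] := BP i.
    by apply: orth (ar i); exact: memv_span.
  pose C i := \sum_(c <- B i) q%:R * `|c| / b.
  have C0 i : 0 <= C i by apply: sumr_ge0 => c _; rewrite divr_ge0 ?(ltW b0)// mulr_ge0.
  pose D := 1 + \sum_i C i.
  have D1 : 1 <= D by rewrite lerDl sumr_ge0.
  exists (M * D); split; first by rewrite mulr_gt0// (lt_le_trans _ D1).
  apply/near_ballP; exists rho => // x /MP[y [yg yh yB xy]] _ s sP.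
  exists y; first by split => // i; have [_ _ _ _] := BP i; apply; exact: yB.
  apply: le_trans xy _; rewrite -mulrA ler_pM2l// mulrDr lerD//.
    rewrite ler_peMl// addr_ge0// sumr_ge0// => i _.
    by rewrite le_max lexx orbT.
  rewrite mulr_sumr; apply: ler_sum => i _.
  apply: (@le_trans _ _ (C i * nY (Phi i x - s i))); last first.
    rewrite ler_wpM2r ?is_norm_ge0// /D (bigD1 i)//= addrCA lerDl.
    by rewrite addr_ge0// sumr_ge0.
  rewrite /C big_distrl/= big_seq [leRHS]big_seq; apply: ler_sum => c cB.
  have [_ _ orth _ _] := BP i.
  have -> : dotp c (Phi i x) = dotp c (Phi i x - s i).
    by rewrite dotpBr (orth c (s i) (memv_span cB) (sP i)) subr0.
  apply: le_trans (dotp_norm_le _ _) _; rewrite -[leRHS]mulrA ler_wpM2l ?mulr_ge0//.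
  by rewrite ler_pdivlMl.
have [M MP] := choice branch.
have Phi_near i (P : 'rV[R]_q -> Prop) :
    (\forall y \near Phi i xs, P y) -> \forall x \near xs, P (Phi i x).
  move=> nP; have cP := differentiable_continuous ((C1Phi i).1 xs).
  exact: cP nP.
have near1 : \forall x \near xs, forall r, act r ->
    forall s : 'I_l -> 'rV[R]_q, (forall i, s i \in Sr (r i)) ->
    exists2 y, feasible_set g h Phi S y &
      `|x - y| <= M r * (res x + \sum_i nY (Phi i x - s i)).
  by apply: near_forall => r; exact: (MP r).2.
have near2 : \forall x \near xs, forall i e, 0 < e -> exists r s,
    [/\ Phi i xs \in Sr r, s \in Sr r &
        nY (Phi i x - s) <= norm_dist nY S (Phi i x) + e].
  by apply: near_forall => i; exact: (Phi_near i _ (active_branch_approx normY (xsS i))).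
have /near_ballP[rho rho0 rhoP] := near_and near1 near2.
pose K := a * \sum_r M r.
have sM0 : 0 <= \sum_r M r by apply: sumr_ge0 => r _; rewrite ltW// (MP r).1.
have K0 : 0 <= K by rewrite mulr_ge0// ltW.
exists K, (a' * rho); split => // [|x xrho]; first by rewrite mulr_gt0.
have [] := rhoP x.
  by rewrite -(ltr_pM2l a'0); apply: le_lt_trans (a'P _) xrho.
move=> {}near1 {}near2; rewrite -/S -/(res x).
apply/ler_addgt0Pr => e e0.
have Kl0 : 0 < K * l%:R + 1 by rewrite ltr_wpDl// mulr_ge0.
have [r rP] := choice (fun i => near2 i _ (divr_gt0 e0 Kl0)).
have [s sP] := choice rP.
have [||y yF xy] := near1 [ffun i => r i] _ s.
- by move=> i; rewrite ffunE; have [] := sP i.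
- by move=> i; rewrite ffunE; have [] := sP i.
have res0 : 0 <= res x + \sum_i nY (Phi i x - s i).
  rewrite !addr_ge0// sumr_ge0// => i _; first by rewrite le_max lexx orbT.
  exact: is_norm_ge0.
apply: le_trans (norm_dist_le normX x yF) _.
apply: le_trans (aP _) _.
apply: (@le_trans _ _ (K * (res x + \sum_i nY (Phi i x - s i)))).
  rewrite /K -mulrA ler_pM2l//; apply: le_trans xy _; rewrite ler_wpM2r//.
  rewrite (bigD1 [ffun i => r i])//= lerDl sumr_ge0// => r' _.
  by rewrite ltW// (MP r').1.
apply: (@le_trans _ _ (K * (res x + \sum_i (norm_dist nY S (Phi i x)
    + e / (K * l%:R + 1))))).
  rewrite ler_wpM2l// lerD2l; apply: ler_sum => i _.
  by have [] := sP i.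
rewrite big_split/= sumr_const card_ord addrA mulrDr lerD2l.
have -> : K * (e / (K * l%:R + 1) *+ l) = e * (K * l%:R / (K * l%:R + 1)).
  by rewrite -(mulr_natr _ l); ring.
by rewrite ler_piMr ?(ltW e0)// ler_pdivrMr// mul1r lerDl.
Qed.
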